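(* The compactification $(\bar\iota,\overline\Sigma^{\mathbb N},\mathfrak{s})$ of $(\Theta,G)$ is uniquely characterized (up to isomorphism of compactifications) by either one of the following properties. (1) It is the smallest compactification of $(\Theta,G)$ that respects $\eta$: it respects $\eta$, with $\bar\iota$-extension denoted $\bar\eta$, and for every compactification $(\tilde\iota,\tilde X,\tilde f)$ of $(\Theta,G)$ respecting $\eta$ with $\tilde\iota$-extension $\tilde\eta$ there is a continuous surjective map $\phi:\tilde X\to\overline\Sigma^{\mathbb N}$ with $\phi\circ\tilde\iota=\bar\iota$, $\phi\circ\tilde f=\mathfrak{s}\circ\phi$ and $\tilde\eta=\bar\eta\circ\phi$. (2) It is the smallest compactification of $(\Theta,G)$ that respects $\mathrm{ord}$: it respects $\mathrm{ord}$, with $\bar\iota$-extension denoted $\overline{\mathrm{ord}}$, and for every compactification $(\tilde\iota,\tilde X,\tilde f)$ of $(\Theta,G)$ respecting $\mathrm{ord}$ with $\tilde\iota$-extension $\widetilde{\mathrm{ord}}$ there is a continuous surjective map $\phi:\tilde X\to\overline\Sigma^{\mathbb N}$ with $\phi\circ\tilde\iota=\bar\iota$, $\phi\circ\tilde f=\mathfrak{s}\circ\phi$ and $\widetilde{\mathrm{ord}}=\overline{\mathrm{ord}}\circ\phi$. Consequently, every compactification of $(\Theta,G)$ that respects $\eta$ also respects $\mathrm{ord}$, and vice versa.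
   Context: $\Theta:=(-\frac12,\frac12)\setminus\mathbb Q$; $G:\Theta\to\Theta$ sends $\theta$ to the unique element of $\Theta$ congruent to $-1/\theta$ modulo $1$. $\mathbb T=\mathbb R/\mathbb Z$. Compactifications: for a continuous self-map $f:X\to X$ of a topological space, a compactification of $(X,f)$ is a triple $(j,\bar X,\bar f)$ with $j:X\to\bar X$ an embedding with dense image, $\bar X$ a compact space, and $\bar f:\bar X\to\bar X$ continuous with $\bar f\circ j=j\circ f$. It respects an embedding $h:X\to Y$ into a compact space $Y$ if there is a continuous $\bar h:\bar X\to Y$ (a $j$-extension of $h$) with $\bar h\circ j=h$. An isomorphism between two compactifications is a homeomorphism intertwining the embeddings and the self-maps. The space $\overline\Sigma^{\mathbb N}$: $\overline{\mathbb N}=\mathbb N\cup\{\infty\}$ is the one-point compactification of the discrete space $\mathbb N=\{1,2,\ldots\}$, $\Sigma=\{-1,+1\}\times\mathbb N_{\ge2}$, $\overline\Sigma=\{-1,+1\}\times\overline{\mathbb N}_{\ge2}$; $\overline\Sigma^{\mathbb N}$ has the product topology, elements are written $\langle(\varepsilon_n,\bar a_n)\rangle_{n\ge1}$, and $\mathfrak s$ is the shift dropping the first entry. For $\theta\in\Theta$ let $\varepsilon(\theta)=\mathrm{sgn}(\theta)$, $\bar a(\theta)=\lfloor1/|\theta|\rfloor$, and $\mathfrak Y(\theta)=\langle(\varepsilon(G^{n-1}(\theta)),\bar a(G^{n-1}(\theta)))\rangle_{n\ge1}\in\Sigma^{\mathbb N}$. Then $\bar\iota:\Theta\to\overline\Sigma^{\mathbb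 N}$ is $\mathfrak Y$ followed by the inclusion $\Sigma^{\mathbb N}\subset\overline\Sigma^{\mathbb N}$; $(\bar\iota,\overline\Sigma^{\mathbb N},\mathfrak s)$ is a compactification of $(\Theta,G)$. Segment embedding: $\eta:\Theta\to[0,1]$, $\eta(\theta)=\theta$ if $\theta>0$ and $\eta(\theta)=\theta+1$ if $\theta<0$. Dynamical embedding: for $\theta\in\Theta$ with $\mathfrak Y(\theta)=\langle(\varepsilon_n,\bar a_n)\rangle$ put $b_n=\bar a_n+\frac{1+\varepsilon_n\varepsilon_{n+1}}2$, $q_{[0]}=1$, $q_{[1]}=b_1$, $q_{[n]}=b_nq_{[n-1]}-\varepsilon_{n-1}\varepsilon_nq_{[n-2]}$ for $n\ge2$, and write $q_{[n]}=q_{[n]}(\theta)$. For $k,l\ge1$ let $\Omega_{k,l}$ be the finite discrete set of ambient isotopy classes of maps $f:\{0,1,\ldots,k\}^{l+1}\to\mathbb T$ ($f\sim g$ if $g=H\circ f$ for an orientation-preserving homeomorphism $H$ of $\mathbb T$), and $\Omega=\prod_{k,l\ge1}\Omega_{k,l}$ with the product topology. $\mathrm{ord}_{k,l}(\theta)\in\Omega_{k,l}$ is the class of $(j_0,\ldots,j_l)\mapsto (j_0q_{[0]}(\theta)+\cdots+j_lq_{[l]}(\theta))\,\theta \bmod 1$, and $\mathrm{ord}:\Theta\to\Omega$ is $\mathrm{ord}(\theta)=\{\mathrm{ord}_{k,l}(\theta)\}_{k,l}$. *)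

(* Defs.v *)
From HB Require Import structures.
From mathcomp Require Import all_boot all_order all_algebra generic_quotient.
From mathcomp Require Import all_classical all_reals all_analysis.
From mathcomp Require Import ring lra.

Set Implicit Arguments.
Unset Strict Implicit.
Unset Printing Implicit Defensive.

Import Order.TTheory GRing.Theory Num.Theory.
Import numFieldNormedType.Exports.

Local Open Scope classical_set_scope.
Local Open Scope ring_scope.
Local Open Scope quotient_scope.

(** * Compactifications of a dynamical system *)

(* The last clause says that [j] is open onto its image. *)
Definition embedding (X Y : topologicalType) (j : X -> Y) : Prop :=
  [/\ continuous j, injective j &
      forall U : set X, open U ->
        exists2 V : set Y, open V & j @` U = V `&` range j].

Definition homeomorphism (X Y : topologicalType) (h : X -> Y) : Prop :=
  continuous h /\ exists g : Y -> X, [/\ continuous g, cancel h g & cancel g h].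

(* No separation axiom is imposed on [Xb]. *)
Definition is_compactification (X : topologicalType) (f : X -> X)
    (Xb : topologicalType) (j : X -> Xb) (fb : Xb -> Xb) : Prop :=
  [/\ compact [set: Xb], embedding j, dense (range j), continuous fb &
      fb \o j = j \o f].

Definition is_extension (X Xb Y : topologicalType) (j : X -> Xb) (h : X -> Y)
    (hb : Xb -> Y) : Prop :=
  continuous hb /\ hb \o j = h.

Definition respects (X Xb Y : topologicalType) (j : X -> Xb) (h : X -> Y)
    : Prop :=
  exists hb : Xb -> Y, is_extension j h hb.

Definition is_factor_map (X : topologicalType)
    (X1 : topologicalType) (j1 : X -> X1) (f1 : X1 -> X1)
    (X2 : topologicalType) (j2 : X -> X2) (f2 : X2 -> X2)
    (phi : X1 -> X2) : Prop :=
  [/\ continuous phi, set_surj [set: X1] [set: X2] phi,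
      phi \o j1 = j2 & phi \o f1 = f2 \o phi].

Definition smallest_respecting (X : topologicalType) (f : X -> X)
    (Y : topologicalType) (h : X -> Y)
    (Xb : topologicalType) (j : X -> Xb) (fb : Xb -> Xb) : Prop :=
  is_compactification f j fb /\
  exists2 hb : Xb -> Y, is_extension j h hb &
    forall (X' : topologicalType) (j' : X -> X') (f' : X' -> X'),
      is_compactification f j' f' ->
      forall h' : X' -> Y, is_extension j' h h' ->
      exists phi : X' -> Xb,
        is_factor_map j' f' j fb phi /\ h' = hb \o phi.

Definition isomorphic_compactifications (X : topologicalType)
    (X1 : topologicalType) (j1 : X -> X1) (f1 : X1 -> X1)
    (X2 : topologicalType) (j2 : X -> X2) (f2 : X2 -> X2) : Prop :=
  exists phi : X1 -> X2,
    [/\ homeomorphism phi, phi \o j1 = j2 & phi \o f1 = f2 \o phi].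

(** * The nearest-integer Gauss map and its symbolic coding *)

Section Gauss.
Context (R : realType).

Definition Theta : set R :=
  [set t | - (1 / 2) < t < 1 / 2] `&` @irrational R.

Lemma Theta_irr (t : Theta) : ~ @rational R (val t).
Proof. by case: t => t /= /set_mem[]. Qed.

Lemma Theta_itv (t : Theta) : - (1 / 2) < val t < 1 / 2.
Proof. by case: t => t /= /set_mem[]. Qed.

Lemma rationalE (x : R) : @rational R x <-> exists q : rat, x = ratr q.
Proof. by rewrite /rational; split => [[q _ <-]|[q ->]]; exists q. Qed.

Lemma Theta_neq0 (t : Theta) : val t != 0.
Proof.
apply/eqP => t0; apply: (@Theta_irr t); apply/rationalE.
by exists 0; rewrite t0 rmorph0.
Qed.

Lemma gauss_subproof (t : Theta) :
  Theta (- (val t)^-1 - (Num.floor (- (val t)^-1 + 1 / 2))%:~R).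
Proof.
set y := - (val t)^-1; set m := Num.floor _.
have irr : ~ @rational R (y - m%:~R).
  move/rationalE => [q Eq]; apply: (@Theta_irr t); apply/rationalE.
  exists (- (q + m%:~R)^-1).
  rewrite rmorphN fmorphV rmorphD /= ratr_int -Eq subrK /y.
  by rewrite invrN invrK opprK.
split=> //=; apply/andP; split.
- rewrite lt_neqAle; apply/andP; split.
    apply/eqP => E; apply: irr; apply/rationalE; exists (- (1 / 2)).
    by rewrite -E rmorphN fmorph_div rmorph1 rmorph_nat.
  by rewrite lerBrDr addrC lerBlDr; exact: floor_le.
- have := floorD1_gt (y + 1 / 2); rewrite -/m intrD => H.
  rewrite ltrBlDr; rewrite -(ltrD2r (1 / 2)).
  apply: (lt_le_trans H).
  by rewrite addrAC [1/2 + 1/2]addrC -splitr addrC.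
Qed.

(* [gauss_map t] is the representative of [-1/t] modulo 1 lying in [Theta]. *)
Definition gauss_map (t : Theta) : Theta := SigSub (mem_set (gauss_subproof t)).

Lemma gaussP (t u : Theta) :
  (- (val t)^-1 - val u \is a Num.int) = (u == gauss_map t).
Proof.
apply/idP/eqP => [tu|->]; last first.
  by rewrite /gauss_map /= opprB addrC subrK rpred_int_num.
have : val u - val (gauss_map t) \is a Num.int.
  have -> : val u - val (gauss_map t) =
      (Num.floor (- (val t)^-1 + 1 / 2))%:~R - (- (val t)^-1 - val u).
    by rewrite /gauss_map /=; ring.
  by rewrite rpredB// intr_int.
case/intrP => z Ez; apply/val_inj/eqP; rewrite -subr_eq0 Ez intr_eq0.
have := Theta_itv u; have := Theta_itv (gauss_map t).
move=> /andP[a b] /andP[c d].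
have : (`|z|%:~R : R) < 1%:~R by rewrite intr_norm -Ez ltr_norml; lra.
by rewrite ltr_int; case: (z) => [[|]|].
Qed.

Definition nat_ge2 : set nat := [set n | (2 <= n)%N].

Lemma abar_subproof (t : Theta) : nat_ge2 (Num.truncn (`|val t|^-1)).
Proof.
rewrite /nat_ge2 /=.
have t0 : 0 < `|val t| by rewrite normr_gt0 Theta_neq0.
rewrite truncn_ge_nat ?invr_ge0// -[2%:R]invrK lef_pV2 ?posrE ?invr_gt0//.
by rewrite -div1r ler_norml; case/andP: (Theta_itv t) => /ltW-> /ltW->.
Qed.

(* In a symbol, the sign [+1] is encoded as [true] and [-1] as [false]; the
   point at infinity of the one-point compactification is [None]. *)
Definition Symbol : Type := (bool * nat_ge2)%type.
Definition Symbolbar : Type :=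
  (bool * one_point_compactification nat_ge2)%type.

HB.instance Definition _ := Topological.on Symbolbar.

Definition Symbol_seqbar : Type := {ptws nat -> Symbolbar}.

HB.instance Definition _ := Topological.on Symbol_seqbar.

Definition symbol_shift (w : Symbol_seqbar) : Symbol_seqbar := fun n => w n.+1.

Definition abar (t : Theta) : nat_ge2 := SigSub (mem_set (abar_subproof t)).

Definition symbol (t : Theta) : Symbol := (0 < val t, abar t).

(* All symbol sequences start at index 0: [coding t n] is the [n.+1]-st symbol
   of [t]; likewise for [eps t n] and [cf_b t n] below. *)
Definition coding (t : Theta) : nat -> Symbol :=
  fun n => symbol (iter n gauss_map t).

Definition coding_bar (t : Theta) : Symbol_seqbar :=
  fun n => ((coding t n).1, Some (coding t n).2).

(** * The segment embedding *)

Definition unit_segment : set R := `[0, 1].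

Lemma segment_subproof (t : Theta) :
  unit_segment (if 0 < val t then val t else val t + 1).
Proof.
have /andP[t1 t2] := Theta_itv t; rewrite /unit_segment /= in_itv /=.
have h : 1 / 2 <= 1 :> R by rewrite div1r invf_le1// ler1n.
case: ltP => t0; apply/andP; split.
- exact: ltW.
- exact: le_trans (ltW t2) h.
- by rewrite -lerBlDr sub0r; apply: le_trans (ltW t1); rewrite lerN2.
- by rewrite -lerBrDr subrr.
Qed.

Definition segment_map (t : Theta) : unit_segment :=
  SigSub (mem_set (segment_subproof t)).

(** * The circle and the ordering of finite configurations *)

Definition eqmod1 (x y : R) : bool := x - y \is a Num.int.

Lemma eqmod1_equiv : equiv_class_of eqmod1.
Proof.
split=> [x|x y|y x z]; rewrite /eqmod1.
- by rewrite subrr rpred0.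
- by rewrite -rpredN opprB.
- by move=> xy yz; rewrite -(subrKA y) rpredD.
Qed.

Canonical eqmod1_equivRel := EquivRelPack eqmod1_equiv.

Definition circle : Type := quotient_topology {eq_quot eqmod1_equivRel}.

HB.instance Definition _ := Topological.on circle.

Definition to_circle (x : R) : circle := \pi_({eq_quot eqmod1_equivRel}) x.

(* The orientation is tested on a lift to the universal cover [R]. *)
Definition orientation_preserving (H : circle -> circle) : Prop :=
  exists h : R -> R,
    [/\ homeomorphism h, {homo h : x y / x < y} &
        forall x, H (to_circle x) = to_circle (h x)].

Definition configuration (k l : nat) : Type :=
  {ffun 'I_l.+1 -> 'I_k.+1} -> circle.

HB.instance Definition _ k l := Choice.on (configuration k l).

Definition isotopic (k l : nat) (f g : configuration k l) : bool :=
  `[< exists H : circle -> circle,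
        [/\ homeomorphism H, orientation_preserving H & g = H \o f] >].

Lemma homeomorphism_id (X : topologicalType) : homeomorphism (@idfun X).
Proof.
have cid : continuous (@idfun X) by move=> x; exact: cvg_id.
by split=> //; exists idfun; split.
Qed.

Lemma homeomorphism_comp (X Y Z : topologicalType) (g : Y -> Z) (f : X -> Y) :
  homeomorphism g -> homeomorphism f -> homeomorphism (g \o f).
Proof.
move=> [cg [g' [cg' gK g'K]]] [cf [f' [cf' fK f'K]]]; split.
  by move=> x; apply: continuous_comp; [exact: cf|exact: cg].
exists (f' \o g'); split; [|exact: can_comp|exact: can_comp].
by move=> x; apply: continuous_comp; [exact: cg'|exact: cf'].
Qed.

Lemma isotopic_equiv (k l : nat) : equiv_class_of (@isotopic k l).
Proof.
have refl : reflexive (@isotopic k l).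
  move=> f; apply/asboolP; exists idfun; split=> //.
    exact: homeomorphism_id.
  by exists idfun; split=> //; exact: homeomorphism_id.
have sym (f g : configuration k l) : isotopic f g -> isotopic g f.
  move=> /asboolP[H [[cH [H' [cH' HK H'K]]]]].
  move=> [h [[ch [h' [ch' hK h'K]]]]].
  move=> hmono Hh gE; apply/asboolP; exists H'; split.
  - by split=> //; exists H; split.
  - exists h'; split.
    + by split=> //; exists h; split.
    + move=> x y xy; rewrite ltNge; apply/negP.
      rewrite le_eqVlt => /predU1P[e|/hmono].
        by move: xy; rewrite -(h'K x) -(h'K y) e ltxx.
      by rewrite !h'K ltNge ltW.
    + by move=> x; rewrite -{1}(h'K x) -Hh HK.
  - by rewrite gE; apply/funext => x /=; rewrite HK.
split=> // [f g|g f e]; first by apply/idP/idP; exact: sym.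
move=> /asboolP[H [HH [h [hh hmono Hh]] gE]].
move=> /asboolP[K [HK [k' [hk kmono Kk]] eE]].
apply/asboolP; exists (K \o H); split.
- exact: homeomorphism_comp.
- exists (k' \o h); split.
  + exact: homeomorphism_comp.
  + by move=> x y xy; apply/kmono/hmono.
  + by move=> x /=; rewrite Hh Kk.
- by rewrite eE gE.
Qed.

Canonical isotopic_equivRel (k l : nat) := EquivRelPack (@isotopic_equiv k l).

Definition Isotopy_class (k l : nat) : Type :=
  discrete_topology {eq_quot (@isotopic_equivRel k l)}.

HB.instance Definition _ k l := Topological.on (Isotopy_class k l).

(* The factor of index [(k, l)] corresponds to the parameters
   [k.+1, l.+1 >= 1]. *)
Definition Omega : Type :=
  prod_topology (fun kl : nat * nat => Isotopy_class kl.1.+1 kl.2.+1).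

HB.instance Definition _ := Topological.on Omega.

Definition eps (t : Theta) (n : nat) : int := sgz (val (iter n gauss_map t)).

(* The division is exact, since [eps] takes the values [1] and [-1]. *)
Definition cf_b (t : Theta) (n : nat) : int :=
  (val (abar (iter n gauss_map t)))%:Z + ((1 + eps t n * eps t n.+1) %/ 2)%Z.

(* [q_pair t n] is the pair [(q_n, q_(n+1))] with [q_0 = 1], [q_1 = b_1] and
   [q_n = b_n q_(n-1) - eps_(n-1) eps_n q_(n-2)], indices counted from 1 in
   [b] and [eps]. *)
Fixpoint q_pair (t : Theta) (n : nat) : int * int :=
  if n is m.+1 then
    let: (q0, q1) := q_pair t m in
    (q1, cf_b t m.+1 * q1 - eps t m * eps t m.+1 * q0)
  else (1, cf_b t 0).

Definition cf_q (t : Theta) (n : nat) : int := (q_pair t n).1.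

Definition ord_configuration (k l : nat) (t : Theta) : configuration k l :=
  fun j => to_circle ((\sum_(i < l.+1) (j i)%:Z * cf_q t i)%:~R * val t).

Definition ord_class (k l : nat) (t : Theta) : Isotopy_class k l :=
  \pi_({eq_quot (@isotopic_equivRel k l)}) (ord_configuration t).

Definition ord_map (t : Theta) : Omega :=
  fun kl => ord_class kl.1.+1 kl.2.+1 t.

End Gauss.

Arguments Theta R : clear implicits.
Arguments unit_segment R : clear implicits.

(* Main.v *)
Require Import Defs.
From mathcomp Require Import all_boot all_order all_algebra.
From mathcomp Require Import all_classical all_reals all_analysis.
From mathcomp Require Import ring lra zify.

(** Write t_i for the i-th iterate of [t] under the Gauss map G. A function on
    Theta extends continuously along a dense embedding [j] as soon as it
    converges when [j t] approaches any given point; this way of approaching a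
    point is the filter [trace_filter], and the extension principle is
    [dense_extension].

    Why eta and ord extend to the symbol space. Both are governed by the signs
    of sums m + d_0 t_0 + d_1 |t_0| t_1 + d_2 |t_0 t_1| t_2 + ... with integer
    coefficients. Since 1/|t_0| = b_0 - eps_0 t_1, dividing such a sum by |t_0|
    gives a sum of the same shape for G(t), with one term less, or with a
    single term and a smaller coefficient; when the first digit tends to
    infinity, t_0 tends to 0 and the constant m decides. So this variant of the
    algorithm of Euclid shows that the sign is constant near every point of the
    symbol space ([sign_stability]). For the sums m + N t this locates [t] up
    to 1/N, which makes the coding an embedding and lets eta extend. Moreover
    q_n t is congruent to |t_0 ... t_(n-1)| t_n modulo 1 ([cf_q_beta]), so
    that the cyclic order of the points j_0 q_0 t + ... + j_l q_l t is given by
    finitely many such signs, and configurations with the same order are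
    exchanged by a homeomorphism of the circle ([isotopic_signs]). Hence ord is
    locally constant in each coordinate.

    Why the symbol space is smallest. In a compactification respecting eta or
    ord, it is enough that the first symbol converges along every trace
    filter: it then extends, and reading it along orbits gives the factor map
    ([coding_bar_smallest]). For eta, the symbol could only remain undecided
    when [t] approaches some 1/n or -1/n; but there G(t) jumps across 0, and
    eta(G(t)), which converges by continuity of the extended dynamics, sees on
    which side [t] lies ([gauss_jump]). For ord, the sign and the first digit
    are read off from the positions of 0, t, 2 t, ..., n t on the circle
    ([ord_class_sign], [ord_class_abar]).

    Uniqueness is formal ([smallest_unique]), and the two notions of respect
    agree because a compactification respecting either map is sent onto the
    symbol space, to which both extend ([smallest_respects]). *)

Set Implicit Arguments.
Unset Strict Implicit.
Unset Printing Implicit Defensive.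

Import Order.TTheory GRing.Theory Num.Theory.
Import numFieldNormedType.Exports.

Local Open Scope classical_set_scope.
Local Open Scope ring_scope.

(** * Extending maps from a dense subset *)

(** Moving along this filter means approaching [x] through the image of [j]. *)
Definition trace_filter (D : Type) (X : topologicalType) (j : D -> X) (x : X) :
  set_system D := filter_from (nbhs x) (preimage j).

Section Trace.
Context (D : Type) (X : topologicalType) (j : D -> X).
Implicit Type x : X.

#[global] Instance trace_filter_filter x : Filter (trace_filter j x).
Proof.
apply: filter_from_filter; first by exists setT; exact: filterT.
by move=> U V nU nV; exists (U `&` V); [exact: filterI|].
Qed.

Lemma trace_filter_proper x : dense (range j) -> ProperFilter (trace_filter j x).
Proof.
move=> dj; apply: filter_from_proper => U.
rewrite nbhsE => -[V [oV Vx] VU].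
have [|y [Vy [t _ tE]]] := dj V _ oV; first by exists x.
by exists t; rewrite /= tE; exact: VU.
Qed.

Lemma trace_filterS x (A : set X) :
  nbhs x A -> \forall t \near trace_filter j x, A (j t).
Proof. by move=> nA; exists A. Qed.

Lemma trace_cvg (Y : topologicalType) (h : X -> Y) x :
  continuous h -> (h \o j) @ trace_filter j x --> h x.
Proof. by move=> ch A /ch nA; exists (h @^-1` A). Qed.

(** An equivariant continuous map carries an approach of [x] to an approach of
    [f x]: this is how a property of [t] is transported to one of [G t]. *)
Lemma trace_comp (g : D -> D) (f : X -> X) x (P : set D) :
  continuous f -> f \o j = j \o g ->
  (\forall t \near trace_filter j (f x), P t) ->
  \forall t \near trace_filter j x, P (g t).
Proof.
move=> cf fj [U nU UP]; exists (f @^-1` U); first exact: cf.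
by move=> t Ut; apply: UP; rewrite /preimage/= -[j (g t)]/((j \o g) t) -fj.
Qed.

(** Sending [x] to the limit of [g] along the trace of [x] is continuous because
    closed neighbourhoods form a basis of [Z]: near [x] the values of [g] stay
    in a closed set, hence so do all nearby limits. *)
Lemma dense_extension (Z : topologicalType) (g : D -> Z) :
  dense (range j) -> hausdorff_space Z -> regular_space Z ->
  (forall x, exists z : Z, g @ trace_filter j x --> z) ->
  exists g' : X -> Z, continuous g' /\ g' \o j = g.
Proof.
move=> dj hZ rZ /choice[g' g'P]; exists g'; split.
  move=> x V /rZ[W nW WV].
  have [U nU UW] := g'P x W nW.
  have [V0 [oV0 V0x] V0U] : exists2 B, open_nbhs x B & B `<=` U.
    by move: nU; rewrite nbhsE.
  suff : nbhs x (g' @^-1` V) by [].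
  rewrite nbhsE; exists V0; first by split.
  move=> y V0y; apply: WV.
  move=> A /(g'P y) gA.
  have gW : (g @ trace_filter j y) W.
    by exists V0; [exact: open_nbhs_nbhs|move=> t /V0U; exact: UW].
  have [t [Wt At]] := @filter_ex _ _ (trace_filter_proper y dj) _ (filterI gW gA).
  by exists (g t).
apply/funext => t; apply/esym/hZ => A B nA nB.
have [U /nbhs_singleton Ut UB] := g'P (j t) B nB.
by exists (g t); split; [exact: nbhs_singleton|exact: UB].
Qed.

End Trace.

Lemma eq_on_dense (D : Type) (X Y : topologicalType) (j : D -> X) (f g : X -> Y) :
  dense (range j) -> hausdorff_space Y -> continuous f -> continuous g ->
  f \o j = g \o j -> f = g.
Proof.
move=> dj hY cf cg fg; apply/funext => x; apply: hY => A B /cf fA /cg gB.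
have [t [fAt gBt]] := @filter_ex _ _ (trace_filter_proper x dj) _
  (filterI (trace_filterS j fA) (trace_filterS j gB)).
exists (f (j t)); split => //=.
by rewrite -[f (j t)]/((f \o j) t) fg.
Qed.

Lemma cvg_prod_topology (I : eqType) (T : I -> topologicalType) (D : Type)
    (F : set_system D) (FF : Filter F) (f : D -> prod_topology T) (p : prod_topology T) :
  (forall i, (fun t => f t i) @ F --> p i) -> f @ F --> p.
Proof.
move=> fp; apply/cvg_sup => i A [_ [[V oV <-] Vp] VA].
have : F ((fun t => f t i) @^-1` V).
  have nV : nbhs (p i) V by exact: open_nbhs_nbhs.
  exact: (fp i V nV).
exact: (@filterS _ F FF _ _ (fun t => VA (f t))).
Qed.

(** * Minimal compactifications *)

Section Smallest.
Context (D Y X : topologicalType) (f : D -> D) (h : D -> Y) (j : D -> X) (fb : X -> X).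

(** The two factor maps are inverse to each other: their composite on [X] is
    the identity on a dense set, and surjectivity of [psi] transports the
    identity to the other side. *)
Lemma smallest_unique (X' : topologicalType) (j' : D -> X') (f' : X' -> X') :
  hausdorff_space X -> smallest_respecting f h j fb ->
  smallest_respecting f h j' f' -> isomorphic_compactifications j' f' j fb.
Proof.
move=> hX [cX [hb hbP minX]] [cX' [hb' hbP' minX']].
have [phi [[cphi _ phij phif] _]] := minX _ _ _ cX' _ hbP'.
have [psi [[cpsi spsi psij psif] _]] := minX' _ _ _ cX _ hbP.
have phiK : phi \o psi = id.
  case: cX => _ _ dj _ _.
  apply: (eq_on_dense dj hX) => //.
  - by move=> x; apply: continuous_comp; [exact: cpsi|exact: cphi].
  - by move=> x; exact: cvg_id.
  - by rewrite -compA psij phij.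
exists phi; split=> //; split=> //; exists psi; split=> //.
- move=> x; have [y _ <-] := spsi x I.
  by rewrite -[phi (psi y)]/((phi \o psi) y) phiK.
- by move=> y; rewrite -[LHS]/((phi \o psi) y) phiK.
Qed.

(** Any compactification that respects [h] maps onto the smallest one, so the
    extension of [h2] can be pulled back. *)
Lemma smallest_respects (Y2 : topologicalType) (h2 : D -> Y2)
  (X' : topologicalType) (j' : D -> X') (f' : X' -> X') :
  smallest_respecting f h j fb -> respects j h2 ->
  is_compactification f j' f' -> respects j' h -> respects j' h2.
Proof.
move=> [_ [hb hbP minX]] [h2b [ch2 h2E]] cX' [h' /(minX _ _ _ cX')].
move=> [phi [[cphi _ phij _] _]]; exists (h2b \o phi); split.
  by move=> x; apply: continuous_comp; [exact: cphi|exact: ch2].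
by rewrite -compA phij.
Qed.

End Smallest.

(** * Functions constant along a filter *)

(** For functions with values in a discrete space this is convergence along
    [F]; it is convenient for finitely many tests at once, and makes sense
    without a topology on [C]. *)
Definition stable (D C : Type) (F : set_system D) (f : D -> C) : Prop :=
  exists c, \forall t \near F, f t = c.

Section Stable.
Context (D : Type) (F : set_system D) {FF : Filter F}.

Lemma stable_comp C C' (g : C -> C') (f : D -> C) :
  stable F f -> stable F (fun t => g (f t)).
Proof. by move=> [c fc]; exists (g c); apply: filterS fc => t ->. Qed.

Lemma stable_comp2 C1 C2 C' (g : C1 -> C2 -> C') (f1 : D -> C1) (f2 : D -> C2) :
  stable F f1 -> stable F f2 -> stable F (fun t => g (f1 t) (f2 t)).
Proof.
by move=> [c fc] [d fd]; exists (g c d); apply: filterS2 fc fd => t -> ->.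
Qed.

Lemma eq_stable C (f g : D -> C) :
  (\forall t \near F, f t = g t) -> stable F f -> stable F g.
Proof. by move=> fg [c fc]; exists c; apply: filterS2 fg fc => t <-. Qed.

Lemma stable_fin (I : finType) C (f : I -> D -> C) :
  (forall i, stable F (f i)) -> stable F (fun t i => f i t).
Proof.
move=> /choice[c fc]; exists c.
have : \forall t \near F, forall i, f i t = c i.
  have : \forall t \near F, forall i, i \in enum I -> f i t = c i.
    elim: (enum I) => [|i s IH]; first exact: nearW.
    apply: filterS2 (fc i) IH => t ti ts k.
    by rewrite inE => /predU1P[->//|]; exact: ts.
  by apply: filterS => t ft i; apply: ft; rewrite mem_enum.
by apply: filterS => t ft; apply/funext.
Qed.

(** The values of [f] need not determine those of [g] through an explicit
    function; an inhabitant of [C'] covers the case of a value of [f] that is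
    not attained. *)
Lemma stable_factor C C' (f : D -> C) (g : D -> C') :
  (forall s t, f s = f t -> g s = g t) -> inhabited C' ->
  stable F f -> stable F g.
Proof.
move=> fg [c'] [c fc].
have [[s sc]|nc] := pselect (exists s, f s = c).
  by exists (g s); apply: filterS fc => t tc; apply: fg; rewrite tc.
by exists c'; apply: filterS fc => t tc; case: nc; exists t.
Qed.

End Stable.

(** * The space of symbol sequences *)

Lemma nat_ge2_discrete (a : nat_ge2) : nbhs a [set a].
Proof.
exists [set a]; split=> //; exists [set val a].
  exact: discrete_open.
by apply/seteqP; split=> x /=; [move/val_inj|move=> ->].
Qed.

Lemma finite_nat_ge2_compact n : compact [set a : nat_ge2 | (val a < n)%N].
Proof.
apply: finite_compact.
have -> : [set a : nat_ge2 | (val a < n)%N] = val @^-1` `I_n by [].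
apply: finite_preimage => //; first by move=> x y _ _; exact: val_inj.
Qed.

Lemma nat_ge2_closed (A : set nat_ge2) : closed A.
Proof.
rewrite -openC openE => a Aa. apply: filterS (nat_ge2_discrete a).
by move=> b ->.
Qed.

Definition digit_ge (n : nat) (x : one_point_compactification nat_ge2) : bool :=
  if x is Some a then (n <= val a)%N else true.

Lemma opc_nbhs_None n :
  nbhs (None : one_point_compactification nat_ge2) [set x | digit_ge n x].
Proof.
exists [set a : nat_ge2 | (val a < n)%N].
  by split; [exact: finite_nat_ge2_compact|exact: nat_ge2_closed].
by move=> [a [[b /= nb [<-]]|]|] //=; rewrite leqNgt; apply/negP.
Qed.

Lemma opc_nbhs_Some a : nbhs (Some a : one_point_compactification nat_ge2) [set Some a].
Proof.
have := one_point_compactification_some_nbhs _ _ (nat_ge2_discrete a).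
by apply: filterS => _ [b -> <-].
Qed.

(** A compact set of integers is bounded, so every neighbourhood of infinity
    contains all large integers. *)
Lemma opc_nbhs_NoneE (U : set (one_point_compactification nat_ge2)) :
  nbhs (None : one_point_compactification nat_ge2) U ->
  exists n, forall x, digit_ge n x -> U x.
Proof.
move=> [K [Kc _] KU].
have /compact_near_coveringP/(_ nat \oo (fun n a => (val a < n)%N) _) := Kc.
case=> [a Ka|n _ nK].
  exists ([set a], [set n | (val a < n)%N]) => /=.
    by split; [exact: nat_ge2_discrete|exact: nbhs_infty_gt].
  by move=> [b m] /= [->].
exists n; move=> [a na|_]; apply: KU; [left|by right].
exists a => // Ka; have := nK n (leqnn n) a Ka.
by rewrite ltnNge (na : (n <= val a)%N).
Qed.

Lemma symbol_eval_continuous n : continuous (fun w : Symbol_seqbar => w n).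
Proof. exact: (@proj_continuous nat (fun=> Symbolbar)). Qed.

Lemma cvg_symbol_seq (T : Type) (F : set_system T) (FF : Filter F)
    (f : T -> Symbol_seqbar) (w : Symbol_seqbar) :
  (forall n, (fun t => f t n) @ F --> w n) -> f @ F --> w.
Proof. exact: (@cvg_prod_topology nat (fun=> Symbolbar)). Qed.

Lemma symbol_shift_continuous : continuous symbol_shift.
Proof.
move=> w; apply: (cvg_symbol_seq (nbhs_filter w)) => n.
exact: (@symbol_eval_continuous n.+1).
Qed.

Lemma nat_ge2_hausdorff : hausdorff_space nat_ge2.
Proof.
move=> a b /(_ _ _ (nat_ge2_discrete a) (nat_ge2_discrete b)).
by move=> [c [-> ->]].
Qed.

Lemma Symbolbar_hausdorff : hausdorff_space Symbolbar.
Proof.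
have hopc : hausdorff_space (one_point_compactification nat_ge2).
  apply: one_point_compactification_hausdorff; last exact: nat_ge2_hausdorff.
  move=> a _; exists [set a].
    by rewrite withinET; exact: nat_ge2_discrete.
  by split; [exact: compact_set1|exact: nat_ge2_closed].
move=> [s1 x1] [s2 x2] clu; congr pair.
- apply: discrete_hausdorff => A B nA nB.
  have [||[s x] [/= [As _] [Bs _]]] := clu (A `*` setT) (B `*` setT).
  + by exists (A, setT) => //=; split=> //; exact: filterT.
  + by exists (B, setT) => //=; split=> //; exact: filterT.
  + by exists s.
- apply: hopc => A B nA nB.
  have [||[s x] [/= [_ As] [_ Bs]]] := clu (setT `*` A) (setT `*` B).
  + by exists (setT, A) => //=; split=> //; exact: filterT.
  + by exists (setT, B) => //=; split=> //; exact: filterT.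
  + by exists x.
Qed.

Lemma Symbolbar_compact : compact [set: Symbolbar].
Proof.
rewrite -setXTT; apply: compact_setX; last exact: one_point_compactification_compact.
by apply: finite_compact; exact: finite_finset.
Qed.

Lemma Symbolbar_regular : regular_space Symbolbar.
Proof.
move=> z; apply: (@compact_regular _ z setT); first exact: Symbolbar_hausdorff.
  exact: Symbolbar_compact.
exact: filterT.
Qed.

Lemma Symbol_seqbar_hausdorff : hausdorff_space Symbol_seqbar.
Proof.
by apply: (@hausdorff_product nat (fun=> Symbolbar)) => _; exact: Symbolbar_hausdorff.
Qed.

Lemma Symbol_seqbar_compact : compact [set: Symbol_seqbar].
Proof.
have := @tychonoff nat (fun=> Symbolbar) (fun=> setT) (fun=> Symbolbar_compact).
by congr (@compact _ _); apply/seteqP; split.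
Qed.

(** * The expansion step and its tail sums *)

Section Arith.
Context (R : realType).
Implicit Types (t : Theta R) (w : Symbol_seqbar).
Local Notation G := (@gauss_map R).

Lemma Theta_lt_half t : `|val t| < 1 / 2.
Proof. by rewrite ltr_norml Theta_itv. Qed.

Lemma Theta_norm_gt0 t : 0 < `|val t|.
Proof. by rewrite normr_gt0 Theta_neq0. Qed.

Lemma eps0E t : eps t 0 = if 0 < val t then 1 else -1.
Proof.
rewrite /eps /=; have := Theta_neq0 t.
by case: (ltgtP 0 (val t)) => // t0 _; [rewrite gtr0_sgz|rewrite ltr0_sgz].
Qed.

Lemma eps_gauss t n : eps (G t) n = eps t n.+1.
Proof. by rewrite /eps iterSr. Qed.

Lemma cf_b_gauss t n : cf_b (G t) n = cf_b t n.+1.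
Proof. by rewrite /cf_b !eps_gauss iterSr. Qed.

Lemma val_eps_norm t : val t = (eps t 0)%:~R * `|val t|.
Proof. by rewrite /eps /= [LHS]numEsg sgrEz. Qed.

Lemma norm_eps_val t : `|val t| = (eps t 0)%:~R * val t.
Proof. by rewrite /eps /= normrEsg sgrEz. Qed.

(** Both inequalities are strict since [val t] is irrational. *)
Lemma abar_itv t : (val (abar t))%:R < `|val t|^-1 < (val (abar t))%:R + 1.
Proof.
have t0 := Theta_norm_gt0 t; rewrite /abar /=.
have /andP[le_ax lt_xa] := @truncn_itv _ `|val t|^-1 (ltW (etrans (invr_gt0 _) t0)).
rewrite -natr1 in lt_xa; rewrite lt_xa andbT lt_neqAle le_ax andbT.
apply/eqP => E; apply: (@Theta_irr _ t); apply/rationalE.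
exists ((eps t 0)%:~R / (Num.truncn `|val t|^-1)%:R).
rewrite rmorphM fmorphV /= ratr_int ratr_nat E invrK.
exact: val_eps_norm.
Qed.

Lemma int_pinch (z c : int) :
  (z - 1)%:~R < c%:~R :> R -> c%:~R < (z + 1)%:~R :> R -> c = z.
Proof. by rewrite !ltr_int; lia. Qed.

(** The expansion step 1/|t| = b - eps * G(t). The integer part of the right
    side is [abar t] or [abar t + 1], according to the sign of eps * G(t);
    this is why [cf_b] involves two consecutive signs. *)
Lemma inv_norm_gauss t :
  `|val t|^-1 = (cf_b t 0)%:~R - (eps t 0)%:~R * val (G t).
Proof.
have /andP[xa xb] := abar_itv t.
have /intrP[z zE] : - (val t)^-1 - val (G t) \is a Num.int by rewrite gaussP.
have := Theta_lt_half (G t); rewrite norm_eps_val => g2.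
have := Theta_norm_gt0 (G t); rewrite norm_eps_val => g0.
have eG : eps (G t) 0 = eps t 1 by rewrite eps_gauss.
rewrite eG in g0 g2.
have xE : `|val t|^-1 = - (eps t 0)%:~R * (z%:~R + val (G t)).
  rewrite -zE subrK norm_eps_val invfM mulNr mulrN opprK; congr (_ * _).
  by rewrite eps0E; case: ifP; rewrite ?rmorphN /= ?invrN invr1.
rewrite xE in xa xb *; rewrite mulrDr mulNr mulNr; congr (_ - _).
rewrite -intrM -mulrNz; congr (_%:~R).
have e0 := eps0E t; have e1 := eps0E (G t); rewrite eG in e1.
have -> : cf_b t 0 = (val (abar t))%:Z + ((1 + eps t 0 * eps t 1) %/ 2)%Z by [].
set a := val (abar t) in xa xb *; set g := val (G t) in xa xb g0 g2 *.
have aE : a%:R = a%:Z%:~R :> R by [].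
rewrite aE in xa xb.
have {e0} : eps t 0 = 1 \/ eps t 0 = -1 by rewrite e0; case: ifP; [left|right].
have {e1} : eps t 1 = 1 \/ eps t 1 = -1 by rewrite e1; case: ifP; [left|right].
move=> [] e1 [] e0; rewrite e0 e1 /= ?rmorphN /= ?rmorph1 in xa xb g0 g2 *.
- rewrite (_ : ((1 + 1 * 1) %/ 2)%Z = 1) //.
  by apply: int_pinch; rewrite ?(intrD, mulrNz, intrM); lra.
- rewrite (_ : ((1 + -1 * 1) %/ 2)%Z = 0) //.
  by apply: int_pinch; rewrite ?(intrD, mulrNz, intrM); lra.
- rewrite (_ : ((1 + 1 * -1) %/ 2)%Z = 0) //.
  by apply: int_pinch; rewrite ?(intrD, mulrNz, intrM); lra.
- rewrite (_ : ((1 + -1 * -1) %/ 2)%Z = 1) //.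
  by apply: int_pinch; rewrite ?(intrD, mulrNz, intrM); lra.
Qed.

(** The sum of the d_i |t_0 ... t_(i-1)| t_i, where t_i is the i-th iterate of
    [t] under the Gauss map. *)
Fixpoint tail_sum (ds : seq int) t : R :=
  if ds is d :: ds' then d%:~R * val t + `|val t| * tail_sum ds' (G t) else 0.

Definition carry (c : int) (ds : seq int) : seq int :=
  if ds is d :: ds' then c + d :: ds' else [:: c].

Lemma tail_sum_carry c ds t :
  tail_sum (carry c ds) t = c%:~R * val t + tail_sum ds t.
Proof. by case: ds => [|d ds] /=; rewrite ?mulr0// intrD mulrDl addrA. Qed.

(** Dividing by |t| and replacing 1/|t| by b - eps * G(t) gives a sum of the
    same kind for G(t): the constant term produces one unit of carry. *)
Lemma tail_sum_renorm m d ds t :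
  m%:~R + tail_sum (d :: ds) t =
  `|val t| * ((m * cf_b t 0 + d * eps t 0)%:~R +
              tail_sum (carry (- (m * eps t 0)) ds) (G t)).
Proof.
have t0 := Theta_norm_gt0 t.
have mE : m%:~R = `|val t| * (m%:~R * ((cf_b t 0)%:~R - (eps t 0)%:~R * val (G t))).
  by rewrite -inv_norm_gauss mulrCA divff ?mulr1// gt_eqF.
have dE : d%:~R * val t = d%:~R * ((eps t 0)%:~R * `|val t|).
  by rewrite -val_eps_norm.
rewrite /= tail_sum_carry {1}mE dE.
by rewrite !(intrD, intrM, mulrNz); ring.
Qed.

Lemma tail_sum_bound ds t :
  `|tail_sum ds t| <= (\sum_(d <- ds) `|d|)%:~R * `|val t|.
Proof.
case: ds t => [|d ds] t /=; first by rewrite big_nil normr0 mul0r.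
have B : forall ds t, `|tail_sum ds t| <= (\sum_(d <- ds) `|d|)%:~R.
  elim=> [|e es IH] u /=; first by rewrite big_nil normr0.
  rewrite big_cons intrD (le_trans (ler_normD _ _))// !normrM normr_id -intr_norm.
  have := Theta_lt_half u => u2.
  have u1 : `|val u| <= 1 by lra.
  apply: lerD; first by rewrite ler_piMr.
  by apply: le_trans (IH (G u)); rewrite ler_piMl.
rewrite big_cons intrD mulrDl (le_trans (ler_normD _ _))// !normrM normr_id.
by rewrite -intr_norm lerD2l mulrC ler_wpM2r.
Qed.

End Arith.

(** * Signs of tail sums near a symbol sequence *)

Section Sign.
Context (R : realType).
Implicit Types (t : Theta R) (w : Symbol_seqbar).
Local Notation G := (@gauss_map R).
Local Notation cyl := (trace_filter (@coding_bar R)).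

Lemma shift_coding : symbol_shift \o @coding_bar R = @coding_bar R \o G.
Proof.
apply/funext => t; apply/funext => n.
by rewrite /= /symbol_shift /coding_bar /coding iterSr.
Qed.

Lemma near_shift w (P : set (Theta R)) :
  (\forall t \near cyl (symbol_shift w), P t) -> \forall t \near cyl w, P (G t).
Proof.
by apply: trace_comp; [exact: symbol_shift_continuous|exact: shift_coding].
Qed.

Lemma stable_shift C w (f : Theta R -> C) :
  stable (cyl (symbol_shift w)) f -> stable (cyl w) (f \o G).
Proof. by move=> [c fc]; exists c; exact: near_shift fc. Qed.

Lemma near_sign w : \forall t \near cyl w, (0 < val t) = (w 0%N).1.
Proof.
exists [set w' : Symbol_seqbar | (w' 0%N).1 = (w 0%N).1]; last by [].
apply: (@symbol_eval_continuous 0 w [set x | x.1 = (w 0%N).1]).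
exists ([set (w 0%N).1], setT); last by move=> [s x] /= [->].
by split; [exact: discrete_set1|exact: filterT].
Qed.

Lemma near_abar w a : (w 0%N).2 = Some a -> \forall t \near cyl w, abar t = a.
Proof.
move=> wa; exists [set w' : Symbol_seqbar | (w' 0%N).2 = Some a].
  apply: (@symbol_eval_continuous 0 w [set x | x.2 = Some a]).
  exists (setT, [set Some a]); last by move=> [s x] /= [_ ->].
  by split; [exact: filterT|rewrite wa; exact: opc_nbhs_Some].
by move=> t /= [].
Qed.

Lemma near_abar_infty w n : (w 0%N).2 = None ->
  \forall t \near cyl w, (n <= val (abar t))%N.
Proof.
move=> wN; exists [set w' : Symbol_seqbar | digit_ge n (w' 0%N).2]; last by [].
apply: (@symbol_eval_continuous 0 w [set x | digit_ge n x.2]).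
exists (setT, [set x | digit_ge n x]); last by move=> [s x] /= [].
by split; [exact: filterT|rewrite wN; exact: (opc_nbhs_None n)].
Qed.

Lemma stable_eps w n : stable (cyl w) (eps (R:=R) ^~ n).
Proof.
elim: n w => [|n IH] w.
  exists (if (w 0%N).1 then 1 else -1).
  by apply: filterS (near_sign w) => t <-; rewrite eps0E.
apply: eq_stable (stable_shift (IH _)).
by apply: nearW => t /=; rewrite /eps iterSr.
Qed.

Lemma stable_cf_b w a : (w 0%N).2 = Some a -> stable (cyl w) (cf_b (R:=R) ^~ 0%N).
Proof.
move=> /near_abar wa; rewrite /cf_b.
apply: (@stable_comp2 _ _ _ _ _ _ (fun x y : int => x + y)).
  by apply: stable_comp; apply: stable_comp; exists a.
apply: (@stable_comp2 _ _ _ _ _ _ (fun x y => ((1 + x * y) %/ 2)%Z)); exact: stable_eps.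
Qed.

Local Notation sign_stable w ds m :=
  (stable (cyl w) (fun t => Num.sg (m%:~R + tail_sum ds t))).

Lemma norm_lt_sg (m x : R) : `|x| < `|m| -> Num.sg (m + x) = Num.sg m.
Proof.
have [m0|m0|->] := ltgtP m 0; last by rewrite normr0 ltNge normr_ge0.
- rewrite (ltr0_norm m0) => /ltr_normlP[h1 h2]; rewrite !ltr0_sg//; lra.
- rewrite (gtr0_norm m0) => /ltr_normlP[h1 h2]; rewrite !gtr0_sg//; lra.
Qed.

(** The renormalisation step. If the first symbol of [w] is finite, or if
    [m = 0], the renormalised coefficients are constant near [w] and the sign
    is that of a sum for G(t). If the first symbol is infinite then [t] tends
    to 0 and a nonzero [m] imposes its sign. *)
Lemma sign_step w m d ds :
  (forall e m' : int, `|e| = 1 -> sign_stable (symbol_shift w) (carry (- (m * e)) ds) m') ->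
  sign_stable w (d :: ds) m.
Proof.
move=> IH.
have reduce : stable (cyl w) (fun t => m * cf_b t 0) -> sign_stable w (d :: ds) m.
  move=> [b mb]; have [e te] := stable_eps w 0.
  (* a constant other than 1 and -1 means that no [t] lies near [w] *)
  have [e1|e1] := eqVneq `|e| 1; last first.
    exists 0; apply: filterS te => t tE; move: e1; rewrite -tE eps0E.
    by case: ifP.
  have /stable_shift[c] := IH e (b + d * e) e1; rewrite /comp => Ec; exists c.
  apply: filterS3 mb te Ec => t mb te <-.
  by rewrite tail_sum_renorm mb te sgrM gtr0_sg ?mul1r// Theta_norm_gt0.
have [m0|m0] := eqVneq m 0.
  apply: reduce; exists 0; apply: nearW => t; by rewrite m0 mul0r.
case E : (w 0%N).2 => [a|].
  by apply: reduce; apply: stable_comp; exact: stable_cf_b E.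
exists (Num.sg m%:~R).
pose S := \sum_(c <- d :: ds) `|c|.
apply: filterS (near_abar_infty `|S|%N E) => t ht.
apply: norm_lt_sg; apply: (le_lt_trans (tail_sum_bound _ _)).
rewrite -/S -ltr_pdivlMr ?Theta_norm_gt0//.
have m1 : 1 <= `|m%:~R| :> R.
  by rewrite -intr_norm ler1z -gtz0_ge1 normr_gt0.
have S0 : 0 <= S by rewrite /S; apply: sumr_ge0.
have /andP[at_ _] := abar_itv t.
have Sa : S%:~R <= (val (abar t))%:R :> R.
  by rewrite -[S]gez0_abs// -pmulrn ler_nat.
apply: (le_lt_trans Sa); apply: (lt_le_trans at_).
by rewrite ler_peMl// invr_ge0 normr_ge0.
Qed.

(** Here the number of terms does not drop, but renormalisation replaces the
    coefficient [d] by one of absolute value |m|, as in the algorithm of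
    Euclid; for |d| <= |m| the constant term wins because |t| < 1/2. *)
Lemma sign_stable1 w m d : sign_stable w [:: d] m.
Proof.
have [n] := ubnP `|d|%N; elim: n w m d => // n IH w m d dn.
have [dm|md] := leP `|d| `|m|.
  exists (Num.sg m%:~R); apply: nearW => t.
  have [d0|d0] := eqVneq d 0; first by rewrite d0 /= mul0r mulr0 !addr0.
  apply: norm_lt_sg; rewrite /= mulr0 addr0 normrM -!intr_norm.
  have d1 : 1 <= `|d|%:~R :> R by rewrite ler1z -gtz0_ge1 normr_gt0.
  have dm' : `|d|%:~R <= `|m|%:~R :> R by rewrite ler_int.
  have := Theta_lt_half t; have := Theta_norm_gt0 t; nra.
apply: sign_step => e m' e1; apply: IH => /=.
by rewrite -ltz_nat abszE normrN normrM e1 mulr1; lia.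
Qed.

(** The carry is absorbed by the next coefficient, so a sum of two terms or
    more loses one term at each renormalisation. *)
Lemma sign_stability w ds m : sign_stable w ds m.
Proof.
have [n] := ubnP (size ds); elim: n w ds m => // n IH w [|d [|d1 ds]] m dn.
- by exists (Num.sg m%:~R); apply: nearW => t /=; rewrite addr0.
- exact: sign_stable1.
- by apply: sign_step => e m' _; apply: IH.
Qed.

End Sign.

(** * The coding is a compactification *)

Section Embed.
Context (R : realType).
Implicit Types (t u : Theta R) (w : Symbol_seqbar).
Local Notation G := (@gauss_map R).
Local Notation cyl := (trace_filter (@coding_bar R)).

Lemma val_continuous : continuous (val : Theta R -> R).
Proof. exact: initial_continuous. Qed.

Lemma inv_val_continuous t : (val t')^-1 @[t' --> t] --> (val t)^-1.
Proof.
exact: (@cvgV _ _ _ _ (fun t' : Theta R => val t') _ (Theta_neq0 t)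
          (@val_continuous t)).
Qed.

Lemma near_open_itv (f : Theta R -> R) t (a b : R) :
  f @ t --> f t -> a < f t < b -> \forall t' \near t, a < f t' < b.
Proof.
move=> cf /andP[af fb].
by apply: filterS2 (cvgr_gt _ cf _ af) (cvgr_lt _ cf _ fb) => t' -> ->.
Qed.

(** The integer subtracted from -1/t is locally constant, as G(t) is never
    equal to 1/2 or -1/2. *)
Lemma gauss_map_continuous : continuous G.
Proof.
apply: continuous_comp_initial => t.
pose m := Num.floor (- (val t)^-1 + 1 / 2).
have cf : (- (val t')^-1 - m%:~R) @[t' --> t] --> - (val t)^-1 - m%:~R.
  exact: (cvgB (cvgN (@inv_val_continuous t)) (cvg_cst _)).
have /(near_open_itv cf) nt := Theta_itv (G t).
have nE : \forall t' \near t, - (val t')^-1 - m%:~R = val (G t').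
  apply: filterS nt => t' /andP[h1 h2].
  rewrite /gauss_map /=; congr (_ - _%:~R); apply/esym/floor_def.
  by rewrite intrD; apply/andP; split; lra.
by apply: cvg_trans cf; exact: near_eq_cvg nE.
Qed.

Lemma symbol_locally_constant t : \forall t' \near t, symbol t' = symbol t.
Proof.
have s : \forall t' \near t, (0 < val t') = (0 < val t).
  have [t0|t0|t0] := ltgtP 0 (val t); last by have := Theta_neq0 t; rewrite -t0 eqxx.
  - by apply: filterS (@cvgr_gt _ _ _ _ _ _ (@val_continuous t) _ t0) => t' ->.
  - apply: filterS (@cvgr_lt _ _ _ _ _ _ (@val_continuous t) _ t0) => t' t'0.
    by apply/negbTE; rewrite -leNgt ltW.
have cn : `|val t'|^-1 @[t' --> t] --> `|val t|^-1.
  rewrite -normfV (_ : (fun _ => _) = (fun t' : Theta R => `|(val t')^-1|)).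
    exact: cvg_norm (@inv_val_continuous t).
  by apply/funext => t'; rewrite normfV.
have a := near_open_itv cn (abar_itv t).
apply: filterS2 s a => t' s a; rewrite /symbol s; congr pair; apply: val_inj => /=.
case/andP: a => a1 a2; apply: truncn_def.
by rewrite (ltW a1) -natr1.
Qed.

Lemma coding_bar_continuous : continuous (@coding_bar R).
Proof.
move=> t; apply: (cvg_symbol_seq (nbhs_filter t)) => n.
have cG : continuous (iter n G).
  elim: n => [|n IH]; first by move=> x; exact: cvg_id.
  by move=> x; apply: (continuous_comp (IH x)); exact: gauss_map_continuous.
have tE : \forall t' \near t, symbol (iter n G t') = symbol (iter n G t).
  exact: (cG t _ (symbol_locally_constant (iter n G t))).
by apply: cvg_near_cst; apply: filterS tE => t' tE; rewrite /coding_bar /coding tE.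
Qed.

(** Near [w] the signs of all m + N t with |m| <= N are constant, so that [t]
    is confined to an interval between two consecutive multiples of 1/N. *)
Lemma near_localized w (e : R) : 0 < e ->
  exists2 A, (\forall t \near cyl w, A t) &
    forall s t, A s -> A t -> `|val s - val t| < e.
Proof.
move=> e0; pose N := (Num.truncn e^-1).+1.
have Ne : e^-1 < N%:R by rewrite /N truncnS_gt.
have N0 : 0 < N%:R :> R by rewrite ltr0n.
move: N Ne N0 => N Ne N0.
have NR : (N%:Z)%:~R = N%:R :> R by [].
pose f (i : 'I_N.*2.+1) t := Num.sg ((i%:Z - N%:Z)%:~R + tail_sum [:: N%:Z] t).
have [c fc] : stable (cyl w) (fun t i => f i t).
  by apply: stable_fin => i; exact: sign_stability.
exists [set t | (fun i => f i t) = c]; first exact: fc.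
suff main s t : (fun i => f i s) = c -> (fun i => f i t) = c -> val s - val t < e.
  by move=> s t ss tt; rewrite ltr_norml ltrNl opprB !main.
move=> <- /(congr1 (fun g => g _)) ft.
have {}ft i : f i s = f i t by rewrite (ft i).
(* [t] is compared with m / N, the last multiple of 1/N below [s] *)
pose m := Num.floor (N%:R * val s).
have /andP[ms sm] : m%:~R <= N%:R * val s < (m + 1)%:~R := floor_itv _.
have /andP[s1 s2] := Theta_itv s.
have Ns1 : N%:R * - (1 / 2) < N%:R * val s by rewrite ltr_pM2l.
have Ns2 : N%:R * val s < N%:R * (1 / 2) by rewrite ltr_pM2l.
have m1 : (- N%:Z < m + 1)%R.
  rewrite -(ltr_int R) mulrNz NR; apply: le_lt_trans sm; lra.
have m2 : (m < N%:Z)%R.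
  by rewrite -(ltr_int R) NR; apply: (le_lt_trans ms); lra.
have iE : exists i : 'I_N.*2.+1, i%:Z - N%:Z = - m.
  have h : (`|N%:Z - m| < N.*2.+1)%N by lia.
  by exists (Ordinal h) => /=; lia.
have [i {}iE] := iE.
have := ft i; rewrite /f iE /= !mulr0 !addr0 mulrNz NR.
have le0 (x : R) : (0 <= Num.sg x) = (0 <= x) by rewrite sgr_ge0.
move=> /(congr1 (fun x => 0 <= x)); rewrite !le0 addrC subr_ge0 ms => /esym.
rewrite addrC subr_ge0 => mt.
have {}mt : m%:~R <= N%:R * val t by rewrite mt.
have NsNt : N%:R * (val s - val t) < 1.
  by rewrite intrD in sm; lra.
rewrite -ltr_pdivlMl// in NsNt.
by apply: (lt_trans NsNt); rewrite mulr1 invf_plt ?posrE.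
Qed.

Lemma coding_bar_localized t (U : set (Theta R)) : nbhs t U ->
  \forall t' \near cyl (coding_bar t), U t'.
Proof.
move=> [_ [[V oV <-] Vt] VU].
have /nbhs_ballP[e e0 eV] : nbhs (val t) V by apply: open_nbhs_nbhs; split.
have [A [W nW WA] At] := near_localized (coding_bar t) e0.
exists W => // t' /WA At'; apply: VU.
suff : ball (val t) e (val t') by exact: eV.
apply: At => //; apply: WA; exact: (nbhs_singleton nW).
Qed.

Lemma coding_bar_embedding : embedding (@coding_bar R).
Proof.
split; first exact: coding_bar_continuous.
- move=> t u tu; apply/val_inj/eqP; rewrite -subr_eq0 -normr_eq0 eq_le normr_ge0 andbT.
  apply/ler_addgt0Pl => e e0; rewrite addr0 ltW//.
  have [A [W nW WA] At] := near_localized (coding_bar t) e0.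
  by apply: At; apply: WA; rewrite /preimage /= -?tu; exact: (nbhs_singleton nW).
- move=> U oU; exists [set w | cyl w U].
    rewrite openE => w [W nW WU]; apply: filterS (nbhs_interior nW) => w' Ww'.
    by exists W.
  apply/seteqP; split=> [w [t Ut tw]|w [[W nW WU] [t _ tE]]].
      rewrite -tw; split; last by exists t.
    by apply: coding_bar_localized; exact: open_nbhs_nbhs.
  by exists t => //; apply: WU; rewrite /preimage /= tE; exact: (nbhs_singleton nW).
Qed.

Lemma Theta_nonempty : inhabited (Theta R).
Proof.
have h : Theta R (pi / 16).
  split=> /=; last first.
    move=> /rationalE[q qE]; apply: (@pi_irrationnal R); apply/rationalE.
    by exists (q * 16); rewrite rmorphM /= -qE rmorph_nat divfK.
  (* pi < 4 *)
  by have := pi_gt0 R; have := pihalf_lt2 R; move=> p1 p2; apply/andP; split; lra.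
by constructor; exact: (SigSub (mem_set h)).
Qed.

Lemma inverse_branch_itv (s : bool) (n : nat) (v : R) : 0 < `|v| -> `|v| < 1 / 2 ->
  n%:R < n%:R + (s == (0 < v) : nat)%:R - (if s then 1 else -1) * v < n%:R + 1.
Proof.
case: (ltP 0 v) => v0; rewrite ?(gtr0_norm v0) ?(ler0_norm v0); case: s.
all: by rewrite /= => v1 v2; apply/andP; split; lra.
Qed.

(** Every symbol is admissible in front of every coding: the preimage of [u] is
    eps / (b - eps * u), where [b] is the digit chosen in accordance with the
    sign of [u]. *)
Lemma symbol_realized (s : Symbol) u : exists2 t, symbol t = s & G t = u.
Proof.
case: s => s a.
pose e : R := if s then 1 else -1.
pose b : int := (val a)%:Z + (s == (0 < val u)).
(* the inverse of the absolute value of the preimage *)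
pose x := b%:~R - e * val u.
have u2 := Theta_lt_half u; have u0 := Theta_norm_gt0 u.
have /andP[ax xa] : (val a)%:R < x < (val a)%:R + 1.
  by rewrite /x /b intrD; exact: inverse_branch_itv.
have a2 : 2 <= (val a)%:R :> R by case: (a) => /= n /set_mem; rewrite ler_nat.
have x2 : 2 < x by exact: le_lt_trans ax.
have x0 : 0 < x by lra.
have e1 : e * e = 1 by rewrite /e; case: (s); lra.
have eN : `|e| = 1 by rewrite /e; case: (s); rewrite ?normrN normr1.
have eV : e^-1 = e by rewrite -[LHS]mulr1 -e1 mulKf// -normr_gt0 eN.
have tP : Theta R (e / x).
  split.
    have : `|e / x| < 1 / 2.
      by rewrite normrM eN mul1r normfV gtr0_norm// div1r ltf_pV2 ?posrE.
    by rewrite ltr_norml.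
  move=> /rationalE[q qE]; apply: (@Theta_irr _ u); apply/rationalE.
  exists ((if s then 1 else -1) * b%:~R - q^-1).
  rewrite rmorphB fmorphV /= -qE rmorphM /= ratr_int invfM invrK eV.
  have -> : ratr (if s then 1 else -1) = e.
    by rewrite /e; case: (s); rewrite ?rmorphN rmorph1.
  by rewrite /x mulrBr mulrA e1 mul1r opprB addrC subrK.
exists (SigSub (mem_set tP)); last first.
  apply/esym/eqP; rewrite -gaussP /= invfM invrK eV /x mulrBr mulrA e1 mul1r.
  rewrite opprB addrAC subrr add0r.
  by rewrite rpredN rpredM// ?intr_int// /e; case: (s); rewrite ?rpredN rpred1.
rewrite /symbol /=; congr pair; last first.
  apply: val_inj => /=; apply: truncn_def.
  by rewrite normrM eN mul1r normfV invrK gtr0_norm// (ltW ax) -natr1.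
by rewrite /e; case: (s); rewrite ?mul1r ?mulN1r ?oppr_gt0 ?invr_gt0 ?invr_lt0 ?x0// lt_gtF.
Qed.

Lemma prefix_realized n (s : nat -> Symbol) :
  exists t, forall i, (i < n)%N -> coding t i = s i.
Proof.
elim: n s => [|n IH] s; first by case: Theta_nonempty => t; exists t.
have [u uP] := IH (fun i => s i.+1); have [t ts tu] := symbol_realized (s 0%N) u.
exists t => -[_|i /uP iP]; first exact: ts.
by rewrite /coding iterSr tu.
Qed.

(** A sequence [w] is the limit of codings whose n-th member agrees with [w] on
    the first n places, each infinite digit being replaced by an integer of
    size at least n. *)
Lemma dense_coding_bar : dense (range (@coding_bar R)).
Proof.
move=> V [w Vw] oV.
have ge2 n : nat_ge2 (maxn n 2) by rewrite /nat_ge2 /= leq_maxr.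
pose s n i : Symbol := ((w i).1, if (w i).2 is Some a then a else SigSub (mem_set (ge2 n))).
have /choice[t tP] n := prefix_realized n (s n).
have : coding_bar (t n) @[n --> \oo] --> w.
  apply: (cvg_symbol_seq _) => i.
  have tE : \forall n \near \oo, coding_bar (t n) i = ((s n i).1, Some (s n i).2).
    by exists i.+1 => // n /= ni; rewrite /coding_bar tP.
  move=> A [[P Q] [/= nP nQ] PQA].
  have nQ' : \forall n \near \oo, Q (Some (s n i).2).
    rewrite /s /=; case: (w i).2 nQ => [a|] nQ.
      by apply: nearW => n; exact: (nbhs_singleton nQ).
    have [m mQ] := opc_nbhs_NoneE nQ; exists m => // n /= mn; apply: mQ => /=.
    by rewrite (leq_trans mn)// leq_maxl.
  apply: filterS2 tE nQ' => n tE Qs; apply: PQA.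
  suff : (P `*` Q) (coding_bar (t n) i) by [].
  by rewrite tE; split=> //=; exact: (nbhs_singleton nP).
move=> /(_ V); have nV : nbhs w V by exact: open_nbhs_nbhs.
move=> /(_ nV) [n _ /(_ n (leqnn n)) /= Vt].
by exists (coding_bar (t n)); split=> //; exists (t n).
Qed.

Lemma coding_bar_compactification :
  is_compactification G (@coding_bar R) symbol_shift.
Proof.
split; [exact: Symbol_seqbar_compact|exact: coding_bar_embedding|
  exact: dense_coding_bar|exact: symbol_shift_continuous|exact: shift_coding].
Qed.

End Embed.

(** * A criterion for minimality *)

Section Criterion.
Context (R : realType).
Implicit Types (t u : Theta R) (w : Symbol_seqbar).
Local Notation G := (@gauss_map R).
Local Notation symbol_bar t := (((symbol t).1, Some (symbol t).2) : Symbolbar).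

(** The digit either exceeds every integer eventually, and then tends to
    infinity, or is eventually equal to the last integer that it reaches. *)
Lemma symbol_cvg (F : set_system (Theta R)) : ProperFilter F ->
  stable F (fun t => 0 < val t) -> (forall n, stable F (fun t => (n <= val (abar t))%N)) ->
  exists z : Symbolbar, (fun t => symbol_bar t) @ F --> z.
Proof.
move=> FF [s sP] stab.
have [large|/existsNP[n0 n0P]] :=
    pselect (forall n, \forall t \near F, (n <= val (abar t))%N).
  exists (s, None) => A [[P Q] [/= nP nQ] PQA].
  have [n nQ'] := opc_nbhs_NoneE nQ.
  apply: filterS2 sP (large n) => t ts tn; apply: PQA; split => /=.
    by rewrite ts; exact: nbhs_singleton nP.
  exact: nQ'.
have ex : exists n, `[< ~ \forall t \near F, (n <= val (abar t))%N >].
  by exists n0; apply/asboolP.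
case: (ex_minnP ex) => n /asboolP nn nmin.
have n1 : (0 < n)%N.
  by rewrite lt0n; apply/eqP => n00; apply: nn; rewrite n00; exact: nearW.
have small : \forall t \near F, (val (abar t) < n)%N.
  have [[] cP] := stab n; first by case: nn; apply: filterS cP => t ->.
  by apply: filterS cP => t /negbT; rewrite -ltnNge.
have big : \forall t \near F, (n.-1 <= val (abar t))%N.
  apply: contrapT => h.
  have /nmin : `[< ~ \forall t \near F, (n.-1 <= val (abar t))%N >] by apply/asboolP.
  by rewrite leqNgt prednK// leqnn.
have eqa : \forall t \near F, val (abar t) = n.-1.
  apply: filterS2 small big => t h1 h2; apply/eqP.
  by rewrite eqn_leq h2 andbT -ltnS prednK.
have [t0 t0n] := filter_ex eqa.
exists (s, Some (abar t0)) => A [[P Q] [/= nP nQ] PQA].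
apply: filterS2 sP eqa => t ts ta; apply: PQA; split => /=.
  by rewrite ts; exact: nbhs_singleton nP.
have -> : abar t = abar t0 by apply: val_inj; rewrite ta t0n.
exact: nbhs_singleton nQ.
Qed.

(** If the first symbol is decided along every trace in [X], it extends to a
    continuous function [s] on [X], and the factor map sends [x] to the symbols
    of its orbit, s(x), s(f x), s(f (f x)), ... Surjectivity holds because the
    image is compact and contains the dense set of codings. *)
Lemma coding_bar_smallest (Y : topologicalType) (h : Theta R -> Y) :
  hausdorff_space Y -> respects (@coding_bar R) h ->
  (forall (X : topologicalType) (j : Theta R -> X) (f : X -> X),
     is_compactification G j f -> respects j h ->
     forall x, stable (trace_filter j x) (fun t => 0 < val t) /\
       forall n, stable (trace_filter j x) (fun t => (n <= val (abar t))%N)) ->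
  smallest_respecting G h (@coding_bar R) symbol_shift.
Proof.
move=> hY [hb [chb hbE]] stab; split; first exact: coding_bar_compactification.
exists hb => // X j f cX h' h'P.
have [Xc _ dj cf fj] := cX.
have [s [cs sE]] : exists s : X -> Symbolbar,
    continuous s /\ s \o j = (fun t => symbol_bar t).
  apply: dense_extension => //; [exact: Symbolbar_hausdorff|exact: Symbolbar_regular|].
  move=> x; have [|s1 s2] := stab X j f cX _ x; first by exists h'.
  by apply: symbol_cvg => //; exact: trace_filter_proper.
pose phi x : Symbol_seqbar := fun n => s (iter n f x).
have cphi : continuous phi.
  move=> x; apply: (cvg_symbol_seq (nbhs_filter x)) => n.
  have cfn : continuous (iter n f).
    elim: n => [|n IH]; first by move=> y; exact: cvg_id.
    by move=> y; apply: (continuous_comp (IH y)); exact: cf.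
  by apply: (continuous_comp (cfn x)); exact: cs.
have fnj n t : iter n f (j t) = j (iter n G t).
  by elim: n => //= n ->; rewrite -[f (j _)]/((f \o j) _) fj.
have phij : phi \o j = @coding_bar R.
  apply/funext => t; apply/funext => n; rewrite /phi /= fnj.
  by rewrite -[s (j _)]/((s \o j) _) sE.
exists phi; split; last first.
  have chp : continuous (hb \o phi).
    by move=> x; apply: continuous_comp; [exact: cphi|exact: chb].
  apply: (eq_on_dense dj hY); [by case: h'P|exact: chp|].
  by rewrite -compA phij hbE; case: h'P.
split=> //; last first.
  by apply/funext => x; apply/funext => n; rewrite /phi /= /symbol_shift iterSr.
move=> w _; apply: contrapT => nw.
have cl : closed (range phi).
  apply: compact_closed; first exact: Symbol_seqbar_hausdorff.
  apply: continuous_compact => //; exact: continuous_subspaceT.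
have [||v [vn [t _ tv]]] := @dense_coding_bar R (~` range phi).
- by exists w => -[x _ xw]; apply: nw; exists x.
- exact: closed_openC.
- by apply: vn; exists (j t) => //; rewrite -[phi _]/((phi \o j) t) phij.
Qed.

End Criterion.

(** * The segment embedding *)

Section Segment.
Context (R : realType).
Implicit Types (t u : Theta R) (w : Symbol_seqbar).
Local Notation G := (@gauss_map R).
Local Notation cyl := (trace_filter (@coding_bar R)).
Local Notation eta t := (val (segment_map t)).

Lemma segment_mapE t : eta t = if 0 < val t then val t else val t + 1.
Proof. by []. Qed.

(** Near [w] the sign is constant and [t] is localised, so that eta is Cauchy
    along the trace of [w]. *)
Lemma segment_respects : respects (@coding_bar R) (@segment_map R).
Proof.
have [g [cg gE]] : exists g : Symbol_seqbar -> R,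
    continuous g /\ g \o @coding_bar R = (fun t => eta t).
  apply: dense_extension; [exact: dense_coding_bar|exact: Rhausdorff|
    exact: uniform_regular|].
  move=> w; have FF := trace_filter_proper w (@dense_coding_bar R).
  suff : cauchy ((fun t => eta t) @ cyl w).
    by move=> /cauchy_cvg cF; exists (lim ((fun t => eta t) @ cyl w)); exact: cF.
  apply: cauchy_exP => e e0.
  have [A nA At] := near_localized w e0.
  have nA' : \forall t \near cyl w, A t /\ (0 < val t) = (w 0%N).1.
    by apply: filterS2 nA (near_sign R w).
  have [s [As sw]] := filter_ex nA'.
  exists (eta s); apply: filterS nA' => t [At' tw].
  suff : `|eta s - eta t| < e by [].
  rewrite !segment_mapE sw tw.
  have st := At _ _ As At'; case: ifP => _ //.
  by rewrite [_ - _](_ : _ = val s - val t)//; ring.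
have g01 w : unit_segment R (g w).
  apply: contrapT => ng.
  have oC : open (~` unit_segment R) by apply: closed_openC; exact: interval_closed.
  have [||v [vn [t _ tv]]] := @dense_coding_bar R (g @^-1` (~` unit_segment R)).
  - by exists w.
  - by move/continuousP: cg; apply.
  - apply: vn; rewrite -tv -[g _]/((g \o @coding_bar R) t) gE.
    by case: (segment_map t) => x /= /set_mem.
exists (fun w => SigSub (mem_set (g01 w))); split.
  by apply: continuous_comp_initial => w; exact: cg.
apply/funext => t; apply: val_inj.
by rewrite /= -[g _]/((g \o @coding_bar R) t) gE.
Qed.

Lemma unit_segment_hausdorff : hausdorff_space (unit_segment R).
Proof.
move=> x y clu; apply: val_inj; apply: Rhausdorff => A B nA nB.
have cv : continuous (val : unit_segment R -> R) by exact: initial_continuous.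
have [z [Az Bz]] := clu _ _ (cv _ _ nA) (cv _ _ nB).
by exists (val z).
Qed.

(** At t0 = -1/k the map -1/t takes the integer value k, so G(t) jumps there
    from values just below 0 to values just above 0. In the segment these
    values lie at opposite ends. *)
Lemma gauss_jump (k : int) (t0 : R) : (2 <= `|k|) -> t0 * k%:~R = -1 ->
  exists2 d : R, 0 < d & forall t, `|val t - t0| < d ->
    (val t < t0 -> 3 / 4 < eta (G t)) /\ (t0 < val t -> eta (G t) < 1 / 4).
Proof.
move=> k2 t0k.
have t00 : t0 != 0 by apply/eqP => h; move: t0k; rewrite h mul0r; lra.
have c1 : - x^-1 - k%:~R @[x --> t0] --> - t0^-1 - k%:~R.
  by apply: (cvgB (cvgN _) (cvg_cst _)); exact: (@cvgV _ _ _ _ id _ t00 cvg_id).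
have kE : k%:~R = - t0^-1.
  by apply: (mulfI t00); rewrite t0k mulrN divff.
have c1E : - t0^-1 - k%:~R = 0 by rewrite kE subrr.
rewrite c1E in c1.
have c2 : x * t0 @[x --> t0] --> t0 * t0 by exact: (cvgM cvg_id (cvg_cst _)).
have t02 : 0 < t0 * t0 by rewrite -expr2 exprn_even_gt0.
have : \forall x \near t0, (- 1 / 4 < - x^-1 - k%:~R < 1 / 4) /\ 0 < x * t0.
  have a1 : \forall x \near t0, - 1 / 4 < - x^-1 - k%:~R by apply: (cvgr_gt _ c1); lra.
  have a2 : \forall x \near t0, - x^-1 - k%:~R < 1 / 4 by apply: (cvgr_lt _ c1); lra.
  have a3 : \forall x \near t0, 0 < x * t0 by exact: (cvgr_gt _ c2).
  by apply: filterS3 a1 a2 a3 => x -> ->.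
move=> /nbhs_ballP[d d0 dP]; exists d => // t td.
have [/andP[b1 b2] tt0] : (- 1 / 4 < - (val t)^-1 - k%:~R < 1 / 4) /\ 0 < val t * t0.
  by apply: dP; rewrite /ball /= distrC.
have gE : val (G t) = - (val t)^-1 - k%:~R.
  rewrite /gauss_map /=; congr (_ - _%:~R); apply: floor_def.
  by rewrite intrD; apply/andP; split; lra.
have tn0 := Theta_neq0 t.
have gt0 : val (G t) * (val t * t0) = val t - t0.
  by rewrite gE kE; field; rewrite t00 tn0.
rewrite segment_mapE; split=> h.
- have g0 : val (G t) < 0 by rewrite -(pmulr_llt0 _ tt0) gt0 subr_lt0.
  by rewrite (lt_gtF g0) gE; lra.
- have g0 : 0 < val (G t) by rewrite -(pmulr_lgt0 _ tt0) gt0 subr_gt0.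
  by rewrite g0 gE.
Qed.

Lemma stable_lt_cst (F : set_system (Theta R)) {FF : Filter F} (f : Theta R -> R) (u c : R) :
  f @ F --> u -> u != c -> stable F (fun t => f t < c).
Proof.
move=> fu; case: ltgtP => // uc _.
- by exists true; apply: filterS (cvgr_lt _ fu _ uc) => t ->.
- exists false; apply: filterS (cvgr_gt _ fu _ uc) => t h.
  by apply/negbTE; rewrite -leNgt ltW.
Qed.

Lemma stable_gap (F : set_system (Theta R)) {FF : Filter F} (f : Theta R -> R) (v : R) :
  f @ F --> v -> stable F (fun t => f t < 1 / 4) \/ stable F (fun t => f t < 3 / 4).
Proof.
move=> fv; have [v4|v4] := eqVneq v (1 / 4); last by left; exact: stable_lt_cst fv _.
by right; apply: stable_lt_cst fv _; rewrite v4; apply/eqP; lra.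
Qed.

(** The end of the segment near which eta(G(t)) lies tells on which side of the
    jump [t] is. As eta(G(t)) converges, its limit cannot be near both ends. *)
Lemma stable_jump (F : set_system (Theta R)) {FF : Filter F}
    (side : Theta R -> bool) (v : R) :
  (fun t => eta (G t)) @ F --> v ->
  (\forall t \near F, if side t then 3 / 4 < eta (G t) else eta (G t) < 1 / 4) ->
  stable F side.
Proof.
move=> hv near_side.
have [st|st] := stable_gap hv.
- apply: (eq_stable _ (stable_comp negb st)).
  apply: filterS near_side => t; case: (side t) => h; last by rewrite h.
  by rewrite -leNgt ltW//; lra.
- apply: (eq_stable _ (stable_comp negb st)).
  apply: filterS near_side => t; case: (side t) => h; last by rewrite (lt_trans h)//; lra.
  by rewrite -leNgt ltW.
Qed.

Lemma Theta_neq_inv t (k : int) (t0 : R) : t0 * k%:~R = -1 -> val t != t0.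
Proof.
move=> t0k; apply/eqP => tt0; apply: (@Theta_irr _ t); apply/rationalE.
exists (- (k%:~R)^-1); rewrite tt0 rmorphN fmorphV /= ratr_int.
have k0 : k%:~R != 0 :> R by apply/eqP => h; move: t0k; rewrite h mulr0; lra.
by apply: (mulIf k0); rewrite mulNr mulVf.
Qed.

Lemma stable_lt_inv (F : set_system (Theta R)) {FF : Filter F} (k : int) (t0 u v : R) :
  2 <= `|k| -> t0 * k%:~R = -1 ->
  val @ F --> u -> (fun t => eta (G t)) @ F --> v -> stable F (fun t => val t < t0).
Proof.
move=> k2 t0k tu hv; have [ut0|] := eqVneq u t0; last exact: stable_lt_cst tu.
have [d d0 dP] := gauss_jump k2 t0k.
apply: (stable_jump hv).
have nd : \forall t \near F, `|val t - t0| < d.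
  by have /cvgrPdist_lt/(_ _ d0) := tu; rewrite ut0; apply: filterS => t; rewrite distrC.
apply: filterS nd => t /dP[l r]; have := Theta_neq_inv t t0k.
by case: ltgtP => // h _; [exact: l|exact: r].
Qed.

(** The sign of [t] is the comparison of eta(t) with 1/2. Near 1/2 there are
    both numbers below 1/2 and numbers above -1/2, which the jumps at 1/2 and
    -1/2 distinguish. *)
Lemma stable_sign_eta (F : set_system (Theta R)) {FF : Filter F} (u v : R) :
  (fun t => eta t) @ F --> u -> (fun t => eta (G t)) @ F --> v ->
  stable F (fun t => 0 < val t).
Proof.
move=> hu hv; have [uh|uh] := eqVneq u (1 / 2); last first.
  apply: (eq_stable _ (stable_lt_cst hu uh)); apply: nearW => t.
  have /andP[t1 t2] := Theta_itv t; rewrite segment_mapE.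
  by case: (ltP 0 (val t)) => h; rewrite ?t2 //; apply/negbTE; rewrite -leNgt; lra.
have [d d0 dP] := @gauss_jump (-2) (1 / 2) isT ltac:(by rewrite mulrNz; lra).
have [d' d'0 d'P] := @gauss_jump 2 (- (1 / 2)) isT ltac:(by lra).
apply: (stable_jump hv).
have nd : \forall t \near F, `|eta t - 1 / 2| < d.
  by have /cvgrPdist_lt/(_ _ d0) := hu; rewrite uh; apply: filterS => t; rewrite distrC.
have nd' : \forall t \near F, `|eta t - 1 / 2| < d'.
  by have /cvgrPdist_lt/(_ _ d'0) := hu; rewrite uh; apply: filterS => t; rewrite distrC.
apply: filterS2 nd nd' => t; rewrite segment_mapE; have /andP[t1 t2] := Theta_itv t.
case: (ltP 0 (val t)) => h td td'.
- by apply: (dP t td).1.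
- by apply: (d'P t _).2 => //; rewrite [_ - _](_ : _ = val t + 1 - 1 / 2)//; lra.
Qed.

Lemma le_abarE t n : (2 <= n)%N -> (n <= val (abar t))%N = (`|val t| < n%:R^-1).
Proof.
move=> n2; have t0 := Theta_norm_gt0 t.
have n0 : 0 < n%:R :> R by rewrite ltr0n; exact: ltnW.
have /andP[h1 h2] := abar_itv t.
rewrite -invf_pgt ?posrE//; apply/idP/idP => h.
  by apply: le_lt_trans h1; rewrite ler_nat.
by rewrite -ltnS -(ltr_nat R) -natr1; apply: lt_trans h2.
Qed.

(** Once the sign is known, eta(t) determines the limit of [t], and the digit
    test is a comparison of [t] with 1/n or -1/n. *)
Lemma stable_eta (F : set_system (Theta R)) {FF : Filter F} (u v : R) :
  (fun t => eta t) @ F --> u -> (fun t => eta (G t)) @ F --> v ->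
  stable F (fun t => 0 < val t) /\ forall n, stable F (fun t => (n <= val (abar t))%N).
Proof.
move=> hu hv; have st : stable F (fun t => 0 < val t) := stable_sign_eta hu hv.
split; [exact: st|move=> n].
have [n2|n2] := leqP 2 n; last first.
  exists true; apply: nearW => t; apply: (@leq_trans 2); first exact: ltnW.
  by case: (abar t) => /= a /set_mem.
have n0 : n%:R != 0 :> R by rewrite pnatr_eq0 -lt0n; exact: ltnW.
have nV : 0 < n%:R^-1 :> R by rewrite invr_gt0 ltr0n; exact: ltnW.
case: st => [[] sP].
- have tu : val @ F --> u.
    apply: cvg_trans hu; apply: near_eq_cvg.
    by apply: filterS sP => t t0; rewrite segment_mapE t0.
  have := @stable_lt_inv F FF (- n%:Z) n%:R^-1 u v _ _ tu hv.
  case; [by rewrite normrN; exact: n2|by rewrite mulrNz -pmulrn mulrN mulVf|].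
  move=> c cP; exists c; apply: filterS2 sP cP => t t0 <-.
  by rewrite le_abarE// gtr0_norm.
- have tu : val @ F --> u - 1.
    have hu1 : (fun t => eta t - 1) @ F --> u - 1 by exact: (cvgB hu (cvg_cst _)).
    apply: cvg_trans hu1; apply: near_eq_cvg.
    by apply: filterS sP => t t0; rewrite segment_mapE t0 addrK.
  have := @stable_lt_inv F FF n%:Z (- n%:R^-1) _ v _ _ tu hv.
  case; [exact: n2|by rewrite -pmulrn mulNr mulVf|].
  move=> c cP; exists (~~ c); apply: filterS2 sP cP => t t0 <-.
  have tn : val t != - n%:R^-1.
    by apply: (@Theta_neq_inv t n%:Z); rewrite -pmulrn mulNr mulVf.
  rewrite le_abarE// ler0_norm; last by rewrite leNgt t0.
  by rewrite ltrNl -leNgt le_eqVlt eq_sym (negbTE tn).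
Qed.

Lemma eta_smallest :
  smallest_respecting G (@segment_map R) (@coding_bar R) symbol_shift.
Proof.
apply: coding_bar_smallest; [exact: unit_segment_hausdorff|exact: segment_respects|].
move=> X j f [_ _ _ cf fj] [h [ch hE]] x.
have cvh : continuous (fun y => val (h y)).
  by move=> y; apply: (continuous_comp (ch y)); exact: initial_continuous.
apply: (@stable_eta _ _ (val (h x)) (val (h (f x)))).
  rewrite -hE; exact: (@trace_cvg _ _ j _ _ x cvh).
rewrite -hE => A nA.
exact: (trace_comp cf fj (@trace_cvg _ _ j _ _ (f x) cvh A nA)).
Qed.

End Segment.

(** * Isotopy of finite configurations on the circle *)

Section Isotopy.
Context (R : realType).
Implicit Types (h P : R -> R).

(** Such a map is continuous, as is its inverse; so homeomorphisms of the line
    can be built as isomorphisms of ordered sets. *)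
Definition increasing_bijection h : Prop :=
  {homo h : x y / x < y} /\ forall y, exists x, h x = y.

Lemma increasing_bijection_mono h : increasing_bijection h -> {mono h : x y / x < y}.
Proof. by move=> [hmono _]; apply/leW_mono/le_mono. Qed.

Lemma increasing_bijection_comp h P :
  increasing_bijection h -> increasing_bijection P -> increasing_bijection (h \o P).
Proof.
move=> [h1 h2] [P1 P2]; split; first by move=> x y xy; exact/h1/P1.
by move=> z; have [y <-] := h2 z; have [x <-] := P2 y; exists x.
Qed.

Lemma increasing_bijection_id : increasing_bijection id.
Proof. by split=> // y; exists y. Qed.

Lemma increasing_bijection_continuous h : increasing_bijection h -> continuous h.
Proof.
move=> hb x; have hm := increasing_bijection_mono hb; case: hb => _ hs.
apply/cvgrPdist_lt => e e0.
have [a aE] := hs (h x - e); have [b bE] := hs (h x + e).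
have ax : a < x by rewrite -hm aE; lra.
have xb : x < b by rewrite -hm bE; lra.
have id_x : y @[y --> x] --> x by exact: cvg_id.
apply: filterS2 (cvgr_gt _ id_x _ ax) (cvgr_lt _ id_x _ xb) => y.
by rewrite -(hm a) -(hm y b) aE bE ltr_norml => h1 h2; apply/andP; split; lra.
Qed.

Lemma increasing_bijection_inv h : increasing_bijection h ->
  exists g, [/\ increasing_bijection g, cancel h g & cancel g h].
Proof.
move=> hb; have hm := increasing_bijection_mono hb; case: hb => _ /choice[g gK].
have hK : cancel h g.
  move=> x; apply/eqP; rewrite eq_le !leNgt; apply/andP.
  by split; apply/negP; rewrite -hm gK ltxx.
exists g; split=> //; split; last by move=> y; exists (h y).
by move=> x y xy; rewrite -hm !gK.
Qed.

Lemma increasing_bijection_homeomorphism h :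
  increasing_bijection h -> homeomorphism h.
Proof.
move=> hb; have [g [gb hK gK]] := increasing_bijection_inv hb.
by split; [|exists g; split=> //]; exact: increasing_bijection_continuous.
Qed.

Lemma to_circleP (x y : R) : to_circle x = to_circle y <-> x - y \is a Num.int.
Proof. by split=> [/eqmodP|xy]; [|apply/eqmodP]. Qed.

Lemma translation_int h (z : int) x :
  (forall x, h (x + 1) = h x + 1) -> h (x + z%:~R) = h x + z%:~R.
Proof.
move=> h1; have hn (n : nat) y : h (y + n%:R) = h y + n%:R.
  by elim: n => [|n IH]; rewrite ?addr0// -natr1 !addrA h1 IH.
case: z => n; first exact: hn.
rewrite NegzE mulrNz; apply: (addIr (n.+1%:R)).
by rewrite -hn -[(Posz n.+1)%:~R]/(n.+1%:R) !subrK.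
Qed.

(** A homeomorphism of the line commuting with the translation by 1 descends to
    the circle, and so does its inverse. *)
Lemma circle_map h : increasing_bijection h -> (forall x, h (x + 1) = h x + 1) ->
  exists H : circle R -> circle R,
    [/\ homeomorphism H, orientation_preserving H &
        forall x, H (to_circle x) = to_circle (h x)].
Proof.
move=> hb h1.
have lift g : increasing_bijection g -> (forall x, g (x + 1) = g x + 1) ->
    exists H : circle R -> circle R, continuous H /\ forall x, H (to_circle x) = to_circle (g x).
  move=> gb g1; pose H (c : circle R) : circle R := to_circle (g (repr c)).
  have HE x : H (to_circle x) = to_circle (g x).
    apply/to_circleP.
    have /to_circleP/intrP[z zE] : to_circle (repr (to_circle x)) = to_circle x.
      exact: reprK.
    have -> : repr (to_circle x) = x + z%:~R by rewrite -zE addrC subrK.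
    by rewrite translation_int// addrC addKr intr_int.
  exists H; split => //; apply/quotient_continuous => x.
  rewrite (_ : H \o _ = (to_circle (R:=R)) \o g); last by apply/funext => y; exact: HE.
  apply: continuous_comp; first exact: increasing_bijection_continuous.
  exact: pi_continuous.
have [g [gb hK gK]] := increasing_bijection_inv hb.
have g1 x : g (x + 1) = g x + 1 by rewrite -[x in LHS]gK -h1 hK.
have [H [cH HE]] := lift h hb h1; have [H' [cH' HE']] := lift g gb g1.
exists H; split => //; last first.
  exists h; split => //; first exact: increasing_bijection_homeomorphism.
  by case: hb.
split => //; exists H'; split => // c.
- have -> : c = to_circle (repr c) by apply/esym; exact: reprK.
  by rewrite HE HE' hK.
- have -> : c = to_circle (repr c) by apply/esym; exact: reprK.
  by rewrite HE' HE gK.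
Qed.

(** The identity outside the interval from [a] to 1, and piecewise affine with a
    single break point there, moving [b] to [b']. *)
Definition bend (a b b' x : R) : R :=
  if x <= a then x else if x <= b then a + (x - a) * ((b' - a) / (b - a))
  else if x <= 1 then b' + (x - b) * ((1 - b') / (1 - b)) else x.

Lemma bendK a b b' : a < b < 1 -> a < b' < 1 -> cancel (bend a b b') (bend a b' b).
Proof.
move=> /andP[ab b1] /andP[ab' b'1] x; rewrite /bend.
have [xa|ax] := leP x a; first by rewrite xa.
have s1 : 0 < (b' - a) / (b - a) by apply: divr_gt0; lra.
have s2 : 0 < (1 - b') / (1 - b) by apply: divr_gt0; lra.
have [xb|bx] := leP x b.
  have e1 : 0 < (x - a) * ((b' - a) / (b - a)) by apply: mulr_gt0 => //; lra.
  have e2 : (x - a) * ((b' - a) / (b - a)) <= b' - a.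
    by rewrite mulrCA ler_piMr ?ler_pdivrMr; lra.
  rewrite leNgt ltrDl e1 /= ifT; last by lra.
  by field; apply/andP; split; apply/eqP; lra.
have [x1|x1] := leP x 1.
  have e1 : 0 < (x - b) * ((1 - b') / (1 - b)) by apply: mulr_gt0 => //; lra.
  have e2 : (x - b) * ((1 - b') / (1 - b)) <= 1 - b'.
    by rewrite mulrCA ler_piMr ?ler_pdivrMr; lra.
  rewrite ifF; last by apply/negbTE; rewrite -ltNge; lra.
  rewrite ifF; last by apply/negbTE; rewrite -ltNge; lra.
  rewrite ifT; last by lra.
  by field; apply/andP; split; apply/eqP; lra.
rewrite ifF; last by apply/negbTE; rewrite -ltNge; lra.
rewrite ifF; last by apply/negbTE; rewrite -ltNge; lra.
by rewrite ifF//; apply/negbTE; rewrite -ltNge; lra.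
Qed.

Lemma bend_incr a b b' : a < b < 1 -> a < b' < 1 -> {homo bend a b b' : x y / x < y}.
Proof.
move=> /andP[ab b1] /andP[ab' b'1] x y xy; rewrite /bend.
have s1 : 0 < (b' - a) / (b - a) by apply: divr_gt0; lra.
have s2 : 0 < (1 - b') / (1 - b) by apply: divr_gt0; lra.
have e1 : (b - a) * ((b' - a) / (b - a)) = b' - a by field; apply/eqP; lra.
have e2 : (1 - b) * ((1 - b') / (1 - b)) = 1 - b' by field; apply/eqP; lra.
move: s1 s2 e1 e2; set k1 := (_ / _); set k2 := (_ / _) => s1 s2 e1 e2.
have [xa|xa] := leP x a; have [ya|ya] := leP y a; try lra.
- have [yb|yb] := leP y b; first by nra.
  have [y1|y1] := leP y 1; nra.
- have [xb|xb] := leP x b; have [yb|yb] := leP y b; try nra.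
  + have [y1|y1] := leP y 1; nra.
  + have [x1|x1] := leP x 1; have [y1|y1] := leP y 1; nra.
Qed.

Lemma bend_bijection a b b' : a < b < 1 -> a < b' < 1 -> increasing_bijection (bend a b b').
Proof.
move=> ab ab'; split; first exact: bend_incr.
by move=> y; exists (bend a b' b y); rewrite bendK.
Qed.

(** The points are moved to their targets one at a time, in increasing order:
    once the targets up to [y i0] are reached, the next map bends only what
    lies beyond. *)
Lemma order_extension (T : eqType) (y : T -> R) (s : seq T) (x : T -> R) (i0 : T) :
  (forall i, x i < 1) -> (forall i, y i < 1) ->
  (forall i j, (x i < x j) = (y i < y j)) -> x i0 = y i0 ->
  path (fun i j => y i <= y j) i0 s ->
  exists P, [/\ increasing_bijection P, (forall z, z <= y i0 -> P z = z),
    (forall z, 1 <= z -> P z = z) & {in s, forall i, P (x i) = y i}].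
Proof.
elim: s x i0 => [|i s IH] x i0 x1 y1 xy xy0 /=.
  by move=> _; exists id; split=> //; exact: increasing_bijection_id.
move=> /andP[yi ys].
have [Q [Qb Qfix Q1 Qi]] : exists Q, [/\ increasing_bijection Q,
    (forall z, z <= y i0 -> Q z = z), (forall z, 1 <= z -> Q z = z) & Q (x i) = y i].
  move: yi; rewrite le_eqVlt => /predU1P[yi|yi].
    exists id; split=> //; first exact: increasing_bijection_id.
    have -> : x i = x i0 by apply/eqP; rewrite eq_le !leNgt !xy yi ltxx.
    by rewrite xy0.
  have xi : y i0 < x i < 1 by rewrite x1 -xy0 xy yi.
  have yi1 : y i0 < y i < 1 by rewrite y1 yi.
  have /andP[xi0 xi1] := xi; have /andP[yi0 yi1'] := yi1.
  exists (bend (y i0) (x i) (y i)); split.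
  - exact: bend_bijection.
  - by move=> z za; rewrite /bend za.
  - move=> z z1; rewrite /bend ifF; last by apply/negbTE; rewrite -ltNge; lra.
    rewrite ifF; last by apply/negbTE; rewrite -ltNge; lra.
    have [z1'|//] := leP z 1; have -> : z = 1 by lra.
    by field; apply/eqP; lra.
  - rewrite /bend ifF; last by apply/negbTE; rewrite -ltNge.
    by rewrite lexx; field; apply/eqP; lra.
have Qm := increasing_bijection_mono Qb.
have [|||||P [Pb Pfix P1 Ps]] := IH (Q \o x) i.
- by move=> j /=; rewrite -[1]Q1// Qm.
- exact: y1.
- by move=> j k /=; rewrite Qm.
- exact: Qi.
- exact: ys.
exists (P \o Q); split.
- exact: increasing_bijection_comp.
- by move=> z zy /=; rewrite Qfix// Pfix// (le_trans zy).
- by move=> z z1 /=; rewrite Q1// P1.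
- move=> j; rewrite inE => /predU1P[->|js] /=; last exact: Ps.
  by rewrite Qi Pfix.
Qed.

Lemma periodic_extension P : increasing_bijection P -> P 0 = 0 -> P 1 = 1 ->
  exists h, [/\ increasing_bijection h, (forall x, h (x + 1) = h x + 1) &
    forall (x : R) (m : int), 0 <= x < 1 -> h (x + m%:~R) = P x + m%:~R].
Proof.
move=> Pb P0 P1; have Pm := increasing_bijection_mono Pb; have [_ Ps] := Pb.
pose h x := P (x - (Num.floor x)%:~R) + (Num.floor x)%:~R.
have hE (x : R) (m : int) : 0 <= x < 1 -> h (x + m%:~R) = P x + m%:~R.
  move=> /andP[x0 x1]; rewrite /h.
  have -> : Num.floor (x + m%:~R) = m.
    by apply: floor_def; rewrite intrD; apply/andP; split; lra.
  by rewrite addrK.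
have decomp (x : R) : exists y : R, exists m : int, 0 <= y < 1 /\ x = y + m%:~R.
  exists (x - (Num.floor x)%:~R), (Num.floor x); rewrite subrK; split => //.
  by have := floor_itv x; rewrite intrD => /andP[a b]; apply/andP; split; lra.
have P01 (x : R) : (0 <= P x < 1) = (0 <= x < 1).
  by rewrite -{1}P0 -{1}P1 Pm !leNgt Pm.
exists h; split => //; last first.
  move=> x; have [y [m [y01 ->]]] := decomp x.
  by rewrite hE// -!addrA -[1]/(1%:~R) -intrD hE.
split.
  move=> x x' ; have [y [m [y01 ->]]] := decomp x; have [y' [m' [y'01 ->]]] := decomp x'.
  rewrite !hE// => lt_xx'.
  have /andP[Py0 Py1] : 0 <= P y < 1 by rewrite P01.
  have /andP[Py'0 Py'1] : 0 <= P y' < 1 by rewrite P01.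
  have [mm'|mm'|mm'] := ltgtP m m'.
  - have : (m + 1)%:~R <= m'%:~R :> R by rewrite ler_int; lia.
    by rewrite intrD; lra.
  - have : (m' + 1)%:~R <= m%:~R :> R by rewrite ler_int; lia.
    by rewrite intrD; lra.
  - by move: lt_xx'; rewrite mm' !ltrD2r Pm.
move=> z; have [y [m [y01 ->]]] := decomp z; have [x xE] := Ps y.
by exists (x + m%:~R); rewrite hE ?xE// -P01 xE.
Qed.

(** The signs determine the integer parts and the order of the fractional
    parts; so the problem reduces to moving the fractional parts, with 0 fixed
    thanks to the base point [i0]. *)
Lemma equivariant_interpolation (T : finType) (F F' : T -> R) (i0 : T) :
  F i0 = 0 -> F' i0 = 0 ->
  (forall i j (m : int), Num.sg (m%:~R + (F i - F j)) = Num.sg (m%:~R + (F' i - F' j))) ->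
  exists h, [/\ increasing_bijection h, (forall x, h (x + 1) = h x + 1) &
    forall i, h (F i) = F' i].
Proof.
move=> F0 F'0 sgF.
have ge0 i j (m : int) : (0 <= m%:~R + (F i - F j)) = (0 <= m%:~R + (F' i - F' j)).
  by rewrite -[LHS]sgr_ge0 sgF sgr_ge0.
have fl i : Num.floor (F' i) = Num.floor (F i).
  apply: floor_def; have /andP[a b] := floor_itv (F i).
  have h m : (m%:~R <= F' i) = (m%:~R <= F i).
    have := ge0 i i0 (- m); rewrite F0 F'0 !subr0 mulrNz addrC subr_ge0 => ->.
    by rewrite addrC subr_ge0.
  by rewrite h a ltNge h -ltNge.
pose x i := F i - (Num.floor (F i))%:~R; pose y i := F' i - (Num.floor (F i))%:~R.
have x01 i : 0 <= x i < 1.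
  have := floor_itv (F i); rewrite /x intrD => /andP[a b]; apply/andP; split; lra.
have y01 i : 0 <= y i < 1.
  have := floor_itv (F' i); rewrite fl /y intrD => /andP[a b]; apply/andP; split; lra.
have xy i j : (x i < x j) = (y i < y j).
  rewrite !ltNge; congr (~~ _).
  have := ge0 i j (Num.floor (F j) - Num.floor (F i)); rewrite intrB /x /y => E.
  rewrite -[LHS]subr_ge0 -[RHS]subr_ge0.
  rewrite (_ : _ - _ = (Num.floor (F j))%:~R - (Num.floor (F i))%:~R + (F i - F j));
    last by ring.
  by rewrite E; congr (0 <= _); ring.
have x0 : x i0 = 0 by rewrite /x F0 floor0 subr0.
have y0 : y i0 = 0 by rewrite /y F0 F'0 floor0 subr0.
pose s := sort (fun i j => y i <= y j) (enum T).
have [|||||P [Pb Pfix P1 Ps]] := @order_extension T y s x i0.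
- by move=> i; case/andP: (x01 i).
- by move=> i; case/andP: (y01 i).
- exact: xy.
- by rewrite x0 y0.
- rewrite path_sortedE; last by move=> ? ? ?; exact: le_trans.
  apply/andP; split; first by apply/allP => i _; rewrite y0; case/andP: (y01 i).
  by apply: sort_sorted => i j; exact: le_total.
have [||h [hb h1 hE]] := @periodic_extension P Pb.
- by rewrite Pfix// y0.
- by rewrite P1.
exists h; split => // i.
have {1}-> : F i = x i + (Num.floor (F i))%:~R by rewrite subrK.
by rewrite hE// Ps ?subrK// mem_sort mem_enum.
Qed.

Lemma isotopic_signs k l (F F' : {ffun 'I_l.+1 -> 'I_k.+1} -> R) i0 :
  F i0 = 0 -> F' i0 = 0 ->
  (forall i j (m : int), Num.sg (m%:~R + (F i - F j)) = Num.sg (m%:~R + (F' i - F' j))) ->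
  isotopic (fun i => to_circle (F i) : circle R) (fun i => to_circle (F' i)).
Proof.
move=> F0 F'0 /(equivariant_interpolation F0 F'0)[h [hb h1 hE]].
have [H [Hh Ho HE]] := circle_map hb h1.
apply/asboolP; exists H; split => //.
by apply/funext => i; rewrite /= HE hE.
Qed.

(** For an arbitrary lift, h (x + 1) - h x is a positive integer. If it were at
    least 2, the value h x + 1 would be taken strictly between [x] and [x + 1],
    against the injectivity of the circle map. *)
Lemma isotopic_lift k l (f f' : configuration R k l) : isotopic f f' ->
  exists h, [/\ {homo h : x y / x < y}, (forall x, h (x + 1) = h x + 1) &
    forall i x, f i = to_circle x -> f' i = to_circle (h x)].
Proof.
move=> /asboolP[H [[_ [H' [_ HK _]]] [h [hh hmono HE]] ->]].
exists h; split=> //; last by move=> i x /= ->.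
move=> x.
have [_ [g [_ hK gK]]] := hh.
have hm : {mono h : x y / x < y} by apply/leW_mono/le_mono.
have /to_circleP/intrP[z zE] : to_circle (h (x + 1)) = to_circle (h x).
  by rewrite -!HE; congr H; apply/to_circleP; rewrite addrAC subrr add0r rpred1.
have z0 : (0 < z)%R.
  by rewrite -(ltr_int R) -zE subr_gt0 hm ltrDl ltr01.
suff z1 : ~~ (1 < z)%R.
  have zz : z = 1 by lia.
  by rewrite -[LHS](subrK (h x)) zE zz addrC.
apply/negP => z1.
pose y := g (h x + 1).
have hy : h y = h x + 1 by rewrite /y gK.
have xy : x < y by rewrite -hm hy ltrDl ltr01.
have yx : y < x + 1.
  rewrite -hm hy -ltrBrDl zE -[1]/(1%:~R) ltr_int; exact: z1.
have : H (to_circle y) = H (to_circle x).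
  by rewrite !HE hy; apply/to_circleP; rewrite addrAC subrr add0r rpred1.
move=> /(can_inj HK)/to_circleP/intrP[n nE].
have : (0 : int)%:~R < n%:~R :> R by rewrite -nE; lra.
have : n%:~R < (1 : int)%:~R :> R by rewrite -nE; lra.
by rewrite !ltr_int; lia.
Qed.

End Isotopy.

(** * The dynamical embedding *)

Section Ord.
Context (R : realType).
Implicit Types (s t u : Theta R) (w : Symbol_seqbar).
Local Notation G := (@gauss_map R).
Local Notation cyl := (trace_filter (@coding_bar R)).

(** The representative |t_0 ... t_(n-1)| t_n of q_n t modulo 1. *)
Fixpoint beta (n : nat) t : R := if n is m.+1 then `|val t| * beta m (G t) else val t.

Lemma norm_mul_gauss t :
  `|val t| * val (G t) = (cf_b t 0)%:~R * val t - (eps t 0)%:~R.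
Proof.
have t0 := Theta_norm_gt0 t.
have ee : (eps t 0)%:~R * (eps t 0)%:~R = 1 :> R.
  by rewrite eps0E; case: ifP => _; rewrite ?mulrNz ?mulr1z ?mulrNN mulr1.
have gE : val (G t) = (eps t 0)%:~R * ((cf_b t 0)%:~R - `|val t|^-1).
  by rewrite inv_norm_gauss opprB addrC subrK mulrA ee mul1r.
rewrite gE [X in _ = _ * X - _]val_eps_norm mulrBr mulrBr mulrCA mulrA.
by congr (_ - _); [ring|rewrite mulrCA divff ?mulr1// gt_eqF].
Qed.

Lemma beta_rec n t : beta n.+2 t =
  (cf_b t n.+1)%:~R * beta n.+1 t - (eps t n * eps t n.+1)%:~R * beta n t.
Proof.
elim: n t => [|n IH] t.
  rewrite /= (norm_mul_gauss (G t)) eps_gauss cf_b_gauss.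
  by rewrite mulrBr; congr (_ - _); [rewrite mulrCA|rewrite norm_eps_val intrM mulrAC].
rewrite -[beta n.+3 t]/(`|val t| * beta n.+2 (G t)) IH.
rewrite !eps_gauss cf_b_gauss /=.
ring.
Qed.

(** By [beta_rec] the two terms satisfy the same recurrence, and they start
    with values that agree up to integers. *)
Lemma cf_q_beta n t : (cf_q t n)%:~R * val t - beta n t \is a Num.int.
Proof.
suff : (q_pair t n).1%:~R * val t - beta n t \is a Num.int /\
       (q_pair t n).2%:~R * val t - beta n.+1 t \is a Num.int by case.
elim: n => [|n [IH1 IH2]].
  split; first by rewrite /= mul1r subrr rpred0.
  by rewrite /= norm_mul_gauss opprB addrC subrK intr_int.
rewrite beta_rec /=; case: (q_pair t n) IH1 IH2 => q0 q1 /= IH1 IH2; split => //.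
rewrite (_ : _ - _ = (cf_b t n.+1)%:~R * (q1%:~R * val t - beta n.+1 t) -
   (eps t n * eps t n.+1)%:~R * (q0%:~R * val t - beta n t)).
  by rewrite rpredB// rpredM// intr_int.
by rewrite rmorphB /= !intrM /=; ring.
Qed.

Lemma tail_sum_mkseq (f : nat -> int) n t :
  tail_sum (mkseq f n) t = \sum_(i < n) (f i)%:~R * beta i t.
Proof.
elim: n f t => [|n IH] f t; first by rewrite big_ord0.
rewrite big_ord_recl /mkseq /= (iotaDl 1 0) -map_comp; congr (_ + _).
rewrite [map _ _]/(mkseq (f \o addn 1) n) IH mulr_sumr.
by apply: eq_bigr => i _ /=; rewrite mulrCA add1n.
Qed.

Definition ord_lift k l t (j : {ffun 'I_l.+1 -> 'I_k.+1}) : R :=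
  \sum_(i < l.+1) (j i)%:R * beta i t.

Lemma ord_configurationE k l t :
  @ord_configuration R k l t = fun j => to_circle (ord_lift t j).
Proof.
apply/funext => j; apply/to_circleP.
rewrite rmorph_sum /= mulr_suml /ord_lift -sumrB rpred_sum// => i _.
rewrite intrM -mulrA -pmulrn -mulrBr rpredM ?natr_int//; exact: cf_q_beta.
Qed.

(** Only finitely many constants matter: the sum is bounded, so that a large
    constant term decides the sign. *)
Lemma sign_stable_int w ds :
  stable (cyl w) (fun t (m : int) => Num.sg (m%:~R + tail_sum ds t)).
Proof.
pose S := `|(\sum_(d <- ds) `|d|)%R|%N.
pose f (i : 'I_S.*2.+1) t := Num.sg ((i%:Z - S%:Z)%:~R + tail_sum ds t).
have : stable (cyl w) (fun t i => f i t).
  by apply: stable_fin => i; exact: sign_stability.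
apply: stable_factor; last by constructor => ?; exact: 0.
move=> s t ft; apply/funext => m.
have bound u : `|tail_sum ds u| <= S%:R.
  apply: (le_trans (tail_sum_bound _ _)).
  rewrite /S -[S%:R]/(S%:Z%:~R) gez0_abs; last by apply: sumr_ge0.
  rewrite ler_piMr//; last by have := Theta_lt_half u; lra.
  by rewrite ler0z; apply: sumr_ge0.
have [mS|Sm] := leqP `|m|%N S.
  have h : (`|(m + S%:Z)%R| < S.*2.+1)%N by lia.
  have := congr1 (fun g => g (Ordinal h)) ft; rewrite /f /=.
  by have -> : `|(m + S%:Z)%R|%N%:Z - S%:Z = m by lia.
have Sm' : S%:R < `|m%:~R| :> R.
  by rewrite -intr_norm -abszE -pmulrn ltr_nat.
by rewrite !norm_lt_sg// (le_lt_trans (bound _)).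
Qed.

(** Differences of two lifted points of the configuration are tail sums. *)
Lemma ord_class_stable w k l : stable (cyl w) (@ord_class R k l).
Proof.
pose ds (ij : {ffun 'I_l.+1 -> 'I_k.+1} * {ffun 'I_l.+1 -> 'I_k.+1}) :=
  mkseq (fun n => (ij.1 (inord n))%:Z - (ij.2 (inord n))%:Z) l.+1.
have dsE ij t : tail_sum (ds ij) t = ord_lift t ij.1 - ord_lift t ij.2.
  rewrite tail_sum_mkseq /ord_lift -sumrB; apply: eq_bigr => i _.
  by rewrite inord_val intrB mulrBl.
have : stable (cyl w) (fun t ij (m : int) => Num.sg (m%:~R + tail_sum (ds ij) t)).
  by apply: stable_fin => ij; exact: sign_stable_int.
have [t0] := Theta_nonempty R.
apply: stable_factor; last by constructor; exact: (ord_class k l t0).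
move=> s t st; apply/eqmodP; rewrite /= !ord_configurationE.
have z u : ord_lift u ([ffun=> ord0] : {ffun 'I_l.+1 -> 'I_k.+1}) = 0.
  by rewrite /ord_lift big1// => i _; rewrite ffunE mul0r.
apply: (isotopic_signs (z s) (z t)) => i j m.
by have := congr1 (fun g => g (i, j) m) st; rewrite !dsE.
Qed.

Lemma Isotopy_class_nbhs k l (c : Isotopy_class R k l) : nbhs c [set c].
Proof. exact: discrete_set1. Qed.

Lemma Isotopy_class_hausdorff k l : hausdorff_space (Isotopy_class R k l).
Proof.
by move=> c d /(_ _ _ (@Isotopy_class_nbhs _ _ c) (@Isotopy_class_nbhs _ _ d))[e [-> ->]].
Qed.

Lemma Isotopy_class_regular k l : regular_space (Isotopy_class R k l).
Proof.
move=> c V /nbhs_singleton Vc; exists [set c]; first exact: Isotopy_class_nbhs.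
by move=> d /(_ _ (@Isotopy_class_nbhs _ _ d))[e [/= ec ed]]; rewrite -ed ec.
Qed.

Lemma ord_respects : respects (@coding_bar R) (@ord_map R).
Proof.
have ext (kl : nat * nat) : exists g : Symbol_seqbar -> Isotopy_class R kl.1.+1 kl.2.+1,
    continuous g /\ g \o @coding_bar R = @ord_class R kl.1.+1 kl.2.+1.
  apply: dense_extension; [exact: dense_coding_bar|exact: Isotopy_class_hausdorff|
    exact: Isotopy_class_regular|].
  move=> w; have [c cP] := ord_class_stable w kl.1.+1 kl.2.+1.
  by exists c; exact: cvg_near_cst.
pose g w : Omega R := fun kl => projT1 (cid (ext kl)) w.
exists g; split.
  move=> w; apply: (cvg_prod_topology (nbhs_filter w)) => kl.
  by rewrite /g; case: (cid _) => gkl [cg _] /=; exact: cg.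
apply/funext => t; apply: functional_extensionality_dep => kl.
rewrite /g /=; case: (cid _) => gkl [_ gE] /=.
by rewrite -[LHS]/((gkl \o @coding_bar R) t) gE.
Qed.

Lemma Omega_hausdorff : hausdorff_space (Omega R).
Proof.
apply: (@hausdorff_product _ (fun kl : nat * nat => Isotopy_class R kl.1.+1 kl.2.+1)) => kl.
exact: Isotopy_class_hausdorff.
Qed.

(** The multiples of the angle occur in the configuration because q_0 = 1; the
    lift is normalised to fix 0. *)
Lemma ord_class_multiples k l s t : @ord_class R k l s = ord_class k l t ->
  exists h : R -> R, [/\ {homo h : x y / x < y}, (forall x, h (x + 1) = h x + 1), h 0 = 0 &
    forall i, (i <= k)%N -> h (i%:R * val s) - i%:R * val t \is a Num.int].
Proof.
move=> /eqmodP /= /isotopic_lift[h [hmono h1 hE]].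
pose j (i : nat) : {ffun 'I_l.+1 -> 'I_k.+1} :=
  [ffun x => if x == ord0 then inord i else ord0].
have jE i u : (i <= k)%N -> ord_configuration u (j i) = to_circle (i%:R * val u).
  move=> ik; rewrite /ord_configuration big_ord_recl big1 ?addr0.
    by rewrite ffunE eqxx inordK// mulr1.
  by move=> x _; rewrite ffunE /= mul0r.
have hj i : (i <= k)%N -> h (i%:R * val s) - i%:R * val t \is a Num.int.
  move=> ik; rewrite -rpredN opprB; apply/to_circleP; rewrite -(jE _ t ik).
  by apply: hE; exact: jE.
have /intrP[z zE] := hj 0%N (leq0n _); rewrite !mul0r subr0 in zE.
exists (fun x => h x - h 0); split.
- by move=> x y /hmono; rewrite ltrD2r.
- by move=> x; rewrite h1 addrAC.
- by rewrite subrr.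
- by move=> i ik; rewrite addrAC zE rpredB ?intr_int// hj.
Qed.

Lemma int_lt1 (x : R) : x \is a Num.int -> -1 < x < 1 -> x = 0.
Proof.
move=> /intrP[z ->]; rewrite -[1]/(1%:~R) -[- 1%:~R]/((-1)%:~R) !ltr_int => z1.
by have -> : z = 0 by lia.
Qed.

(** The images h (i x) are increasing and lie between 0 and 1. As h (2 x) is
    less than 1, h x cannot represent a negative [y]; then the steps of h (i x)
    all equal [y], since they are congruent to [y] and less than 1. *)
Lemma multiples_below_one (h : R -> R) (x y : R) n :
  {homo h : a b / a < b} -> (forall a, h (a + 1) = h a + 1) -> h 0 = 0 ->
  0 < x -> `|y| < 1 / 2 -> (2 <= n)%N -> n%:R * x < 1 ->
  (forall i, (i <= n)%N -> h (i%:R * x) - i%:R * y \is a Num.int) ->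
  0 < y /\ n%:R * y < 1.
Proof.
move=> hmono h1 h0 x0; rewrite ltr_norml => /andP[y1 y2] n2 nx hxy.
have h11 : h 1 = 1 by rewrite -[1]add0r h1 h0.
have hlt1 i : (i <= n)%N -> h (i%:R * x) < 1.
  move=> iN; rewrite -[ltRHS]h11; apply: hmono; apply: le_lt_trans nx.
  by rewrite ler_pM2r// ler_nat.
have hS i : h (i%:R * x) < h (i.+1%:R * x).
  by apply: hmono; rewrite ltr_pM2r// ltr_nat.
have hx1 := hlt1 1%N (ltnW n2); have hx2 := hlt1 2 n2.
have := hS 0%N; have := hS 1%N; rewrite mul0r h0 => hx12 hx01.
have i1 := hxy 1%N (ltnW n2); have i2 := hxy 2 n2.
rewrite !mul1r in hx1 hx12 hx01 i1.
have y0 : 0 < y.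
  rewrite ltNge; apply/negP => yle.
  have e1 : h x = y + 1.
    apply/eqP; rewrite -subr_eq0; apply/eqP; apply: int_lt1; last by lra.
    by rewrite opprD addrA rpredB// rpred1.
  have e2 : h (2 * x) = 2 * y + 1.
    apply/eqP; rewrite -subr_eq0; apply/eqP; apply: int_lt1; last by lra.
    by rewrite opprD addrA rpredB// rpred1.
  by lra.
split => //.
suff hE i : (i <= n)%N -> h (i%:R * x) = i%:R * y by rewrite -hE// hlt1.
elim: i => [|i IH] iN; first by rewrite !mul0r h0.
have {}IH := IH (ltnW iN).
have step : h (i.+1%:R * x) - h (i%:R * x) = y.
  apply/eqP; rewrite -subr_eq0; apply/eqP; apply: int_lt1.
    have := hxy i.+1 iN; have := hxy i (ltnW iN) => a b.
    rewrite (_ : _ - _ = (h (i.+1%:R * x) - i.+1%:R * y) - (h (i%:R * x) - i%:R * y)).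
      by rewrite rpredB.
    by rewrite -natr1; ring.
  have h0i : 0 <= h (i%:R * x).
    by rewrite IH mulr_ge0// ltW.
  have := hS i; have := hlt1 i.+1 iN; lra.
by rewrite -[LHS](subrK (h (i%:R * x))) step IH -natr1 mulrDl mul1r addrC.
Qed.

Lemma ord_class_sign k l s t : (2 <= k)%N -> @ord_class R k l s = ord_class k l t ->
  (0 < val s) = (0 < val t).
Proof.
move=> k2.
suff imp u v : @ord_class R k l u = ord_class k l v -> 0 < val u -> 0 < val v.
  by move=> st; apply/idP/idP; apply: imp.
move=> /ord_class_multiples[h [hmono h1 h0 hi]] u0.
have [] := @multiples_below_one h (val u) (val v) 2 hmono h1 h0 u0 (Theta_lt_half v) isT => //.
  by have /andP[_] := Theta_itv u; lra.
by move=> i i2; apply: hi; exact: leq_trans k2.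
Qed.

(** The digit is at least n exactly when n |t| < 1, that is, when the first n
    multiples of [t] do not turn around the circle. Negative angles are treated
    by the symmetry x -> - h (- x). *)
Lemma ord_class_abar k l s t n : (2 <= n)%N -> (n <= k)%N ->
  @ord_class R k l s = ord_class k l t -> (n <= val (abar s))%N = (n <= val (abar t))%N.
Proof.
move=> n2 nk.
suff imp u v : @ord_class R k l u = ord_class k l v ->
    (n <= val (abar u))%N -> (n <= val (abar v))%N.
  by move=> st; apply/idP/idP; apply: imp.
move=> uv; have uv0 := ord_class_sign (leq_trans n2 nk) uv.
have [h [hmono h1 h0 hi]] := ord_class_multiples uv.
have n0 : 0 < n%:R :> R by rewrite ltr0n; exact: ltnW.
rewrite !le_abarE// -[n%:R^-1]mul1r !ltr_pdivlMr// ![_ * n%:R]mulrC.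
have hi' i : (i <= n)%N -> h (i%:R * val u) - i%:R * val v \is a Num.int.
  by move=> iN; apply: hi; exact: leq_trans nk.
have [u0|u0|u0] := ltgtP 0 (val u).
- have v0 : 0 < val v by rewrite -uv0.
  rewrite !gtr0_norm// => nu.
  by have [] := multiples_below_one hmono h1 h0 u0 (Theta_lt_half v) n2 nu hi'.
- have v0 : val v < 0.
    by have := Theta_neq0 v; have := lt_gtF u0; rewrite uv0; case: ltgtP.
  rewrite !ltr0_norm// => nu.
  have [||||||||_ nv] := @multiples_below_one (fun x => - h (- x)) (- val u) (- val v) n.
  + by move=> a b ab; rewrite ltrN2; apply: hmono; rewrite ltrN2.
  + by move=> a; have := h1 (- (a + 1)); rewrite opprD subrK => ->; rewrite opprD subrK.
  + by rewrite oppr0 h0 oppr0.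
  + by rewrite oppr_gt0.
  + by rewrite normrN; exact: Theta_lt_half.
  + exact: n2.
  + exact: nu.
  + by move=> i iN; rewrite !mulrN !opprK addrC -opprB rpredN; exact: hi'.
  + exact: nv.
- by have := Theta_neq0 u; rewrite -u0 eqxx.
Qed.

Lemma ord_smallest :
  smallest_respecting G (@ord_map R) (@coding_bar R) symbol_shift.
Proof.
apply: coding_bar_smallest; [exact: Omega_hausdorff|exact: ord_respects|].
move=> X j f cX [h [ch hE]] x.
have st (kl : nat * nat) : stable (trace_filter j x) (@ord_class R kl.1.+1 kl.2.+1).
  exists (h x kl).
  have ckl : continuous (fun y => h y kl).
    have cp : continuous (fun p : Omega R => p kl).
      exact: (@proj_continuous _ (fun kl : nat * nat => Isotopy_class R kl.1.+1 kl.2.+1)).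
    move=> y; exact: (@continuous_comp _ _ _ h (fun p : Omega R => p kl) y (ch y) (cp _)).
  have near_h : \forall t \near trace_filter j x, h (j t) kl = h x kl.
    exact: (@trace_cvg _ _ j _ _ x ckl _ (@Isotopy_class_nbhs _ _ (h x kl))).
  apply: filterS near_h => t <-.
  by rewrite -[h (j t)]/((h \o j) t) hE.
split.
  (* the index (n, 0) stands for the parameters n + 1 and 1; the sign needs the
     multiples of the angle up to 2 *)
  apply: stable_factor (st (1, 0)%N); last by constructor; exact: true.
  by move=> s t; exact: ord_class_sign.
move=> n; have [n2|n2] := leqP 2 n.
  apply: stable_factor (st (n, 0)%N); last by constructor; exact: true.
  by move=> s t; exact: ord_class_abar.
exists true; apply: nearW => t; apply: (@leq_trans 2); first exact: ltnW.
by case: (abar t) => /= a /set_mem.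
Qed.

End Ord.

(** * The characterisations of the symbol space *)

Theorem theoremB (R : realType) :
  [/\ smallest_respecting (@gauss_map R) (@segment_map R) (@coding_bar R) symbol_shift /\
      (forall (X : topologicalType) (j : Theta R -> X) (f : X -> X),
         smallest_respecting (@gauss_map R) (@segment_map R) j f ->
         isomorphic_compactifications j f (@coding_bar R) symbol_shift),
      smallest_respecting (@gauss_map R) (@ord_map R) (@coding_bar R) symbol_shift /\
      (forall (X : topologicalType) (j : Theta R -> X) (f : X -> X),
         smallest_respecting (@gauss_map R) (@ord_map R) j f ->
         isomorphic_compactifications j f (@coding_bar R) symbol_shift) &
      forall (X : topologicalType) (j : Theta R -> X) (f : X -> X),
        is_compactification (@gauss_map R) j f ->
        (respects j (@segment_map R) <-> respects j (@ord_map R))].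
Proof.
have hS := Symbol_seqbar_hausdorff.
have Eta := eta_smallest R; have Ord := ord_smallest R.
split.
- by split => // X j f; exact: smallest_unique.
- by split => // X j f; exact: smallest_unique.
- move=> X j f cX; split.
  + exact: smallest_respects Eta (ord_respects R) cX.
  + exact: smallest_respects Ord (segment_respects R) cX.
Qed.
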